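(* Let $\mathfrak K\subset\mathbb N$ be a subsequence. Let $P$ be an irreducible, recurrent, aperiodic transition matrix on a countable state space $S$, with stationary distribution $\pi$, $\sum_{s\in S}\pi_s=\infty$. The Markov shift $(S^{\mathbb Z},\mathcal B,m,T)$ of $(P,\pi)$ is rationally weakly mixing along $\mathfrak K$ if and only if there exists $s\in S$ such that the weight $u([s]_0)$ is $\mathfrak K$-smooth.
   Context: A subsequence $\mathfrak K\subset\mathbb N$ is an infinite subset. $P:S\times S\to[0,1]$ is a stochastic matrix ($\sum_{t}p_{s,t}=1$ for all $s$) with invariant distribution $\pi:S\to\mathbb R_+$ ($\sum_{u\in S}\pi_up_{u,t}=\pi_t$); $p^{(n)}_{s,t}$ are the entries of $P^n$. $P$ is irreducible if for all $s,t\in S$ there is $n\in\mathbb N$ with $p_{s,t}^{(n)}>0$; recurrent if $\sum_{n\ge0}p^{(n)}_{s,s}=\infty$ for all $s$; aperiodic if $\gcd\{n\ge1:p^{(n)}_{s,s}>0\}=1$ for some (hence all) $s\in S$. The (two-sided, stationary) Markov shift of $(P,\pi)$ is $(S^{\mathbb Z},\mathcal B,m,T)$ with $T$ the shift on $S^{\mathbb Z}$, $\mathcal B$ generated by the cylinders $[s_1,\dots,s_n]_k:=\{x\in S^{\mathbb Z}:x_{j+k}=s_j\ \forall\,1\le j\le n\}$, and $m$ given by $m([s_1,\dots,s_n]_k)=\pi_{s_1}p_{s_1,s_2}\cdots p_{s_{n-1},s_n}$. A weight is a bounded sequence $u=(u_0,u_1,\dots)$ with $u_n\ge0$ and $a_u(n):=\sum_{k=1}^nu_k\to\infty$.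 A weight $u$ is $\mathfrak K$-smooth if $\frac1{a_u(n)}\sum_{k=1}^n|u_k-u_{k+1}|\to0$ as $n\to\infty$, $n\in\mathfrak K$. For $F\in\mathcal B$ with $0<m(F)<\infty$: $u_n(F):=\frac{m(F\cap T^{-n}F)}{m(F)^2}$, $u(F)=(u_n(F))_{n\ge0}$, $a_n(F):=\sum_{k=0}^{n-1}u_k(F)$. (Thus $u_n([s]_0)=p^{(n)}_{s,s}/\pi_s$.) A conservative, ergodic measure preserving transformation $T$ is rationally weakly mixing along $\mathfrak K$ if there is $F\in\mathcal B$ with $0<m(F)<\infty$ such that for all measurable $A,B\subset F$, $\frac1{a_n(F)}\sum_{k=0}^{n-1}|m(A\cap T^{-k}B)-m(A)m(B)u_k(F)|\to0$ as $n\to\infty$, $n\in\mathfrak K$. *)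

(* Defs.v *)
From HB Require Import structures.
From mathcomp Require Import all_boot all_order all_algebra.
From mathcomp Require Import all_classical all_reals all_analysis.

Set Implicit Arguments.
Unset Strict Implicit.
Unset Printing Implicit Defensive.

Import Order.TTheory GRing.Theory Num.Theory.
Import numFieldNormedType.Exports.

Local Open Scope classical_set_scope.
Local Open Scope ring_scope.

Section StochasticMatrices.
Context {R : realType} {S : choiceType}.
Implicit Types (P : S -> S -> R) (pi : S -> R).

Definition stochastic P : Prop :=
  (forall s t, 0 <= P s t <= 1) /\
  (forall s, \esum_(t in [set: S]) (P s t)%:E = 1%E).

(* No normalization: [pi] may have infinite total mass. *)
Definition invariant_distribution P pi : Prop :=
  (forall s, 0 <= pi s) /\
  (forall t, \esum_(u in [set: S]) (pi u * P u t)%:E = (pi t)%:E).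

Fixpoint mpow P (n : nat) (s t : S) : \bar R :=
  if n is n'.+1 then \esum_(u in [set: S]) ((P s u)%:E * mpow P n' u t)%E
  else ((s == t)%:R)%:E.

Definition irreducible_mx P : Prop :=
  forall s t, exists n, (0 < mpow P n s t)%E.

Definition recurrent P : Prop :=
  forall s, (\sum_(0 <= n <oo) mpow P n s s = +oo)%E.

Definition is_gcd_of (A : set nat) (g : nat) : Prop :=
  (forall n, A n -> (g %| n)%N) /\
  (forall d, (forall n, A n -> (d %| n)%N) -> (d %| g)%N).

Definition aperiodic P : Prop :=
  exists s, is_gcd_of [set n | (1 <= n)%N /\ (0 < mpow P n s s)%E] 1.

End StochasticMatrices.

Section MarkovShift.
Context {S : pointedType}.

(* [s_1, ..., s_n]_k; only the values s 1, ..., s n of [s] matter. *)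
Definition cylinder (n : nat) (s : nat -> S) (k : int) : set (int -> S) :=
  [set x | forall j : nat, (1 <= j <= n)%N -> x (j%:Z + k) = s j].

Definition cylinders : set (set (int -> S)) :=
  [set A | exists n s k, (1 <= n)%N /\ A = cylinder n s k].

Definition bilateral : measurableType (sigma_display cylinders) :=
  g_sigma_algebraType cylinders.

Definition state_cylinder (s : S) : set bilateral := cylinder 1 (fun=> s) 0.

Definition shift_map (x : bilateral) : bilateral := fun j : int => x (j + 1).

(* The cylinder values determine [m]: the cylinders of the form [s]_0 cover
   the space, are countably many when S is countable and have finite mass. *)
Definition markov_measure (R : realType) (P : S -> S -> R) (pi : S -> R)
    (m : {measure set bilateral -> \bar R}) : Prop :=
  forall (n : nat) (s : nat -> S) (k : int), (1 <= n)%N ->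
    m (cylinder n s k) = (pi (s 1%N) * \prod_(1 <= j < n) P (s j) (s j.+1))%:E.

End MarkovShift.
Arguments bilateral : clear implicits.
Arguments cylinders : clear implicits.

Section Weights.
Context {R : realType}.
Implicit Types (u : nat -> R) (K : set nat).

Definition weight_sum u (n : nat) : R := \sum_(1 <= k < n.+1) u k.

Definition weight u : Prop :=
  [/\ exists M : R, forall n, u n <= M,
      forall n, 0 <= u n &
      weight_sum u n @[n --> \oo] --> +oo].

(* The filter [within K \oo] is "n tends to infinity with n in K". *)
Definition smooth_along K u : Prop :=
  weight u /\
  (weight_sum u n)^-1 * (\sum_(1 <= k < n.+1) `|u k - u k.+1|)
    @[n --> within K \oo] --> (0 : R).

End Weights.

Section InfiniteErgodicTheory.
Context {d : measure_display} {X : measurableType d} {R : realType}.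
Implicit Types (m : {measure set X -> \bar R}) (T : X -> X) (F : set X).

Definition measure_preserving m T : Prop :=
  measurable_fun setT T /\
  (forall A, measurable A -> m (T @^-1` A) = m A).

Definition wandering T (W : set X) : Prop :=
  measurable W /\ trivIset setT (fun n : nat => iter n T @^-1` W).

Definition conservative m T : Prop :=
  forall W, wandering T W -> m W = 0%E.

Definition ergodic m T : Prop :=
  forall A, measurable A -> T @^-1` A = A -> m A = 0%E \/ m (~` A) = 0%E.

Definition return_weight m T F (n : nat) : R :=
  fine (m (F `&` iter n T @^-1` F)) / fine (m F) ^+ 2.

Definition return_sum m T F (n : nat) : R :=
  \sum_(0 <= k < n) return_weight m T F k.

Definition rationally_weakly_mixing_along (K : set nat) m T : Prop :=
  [/\ measure_preserving m T, conservative m T, ergodic m T &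
  exists F : set X,
    [/\ measurable F, (0 < m F < +oo)%E &
    forall A B : set X, measurable A -> measurable B ->
      A `<=` F -> B `<=` F ->
      (return_sum m T F n)^-1 *
        (\sum_(0 <= k < n)
           `|fine (m (A `&` iter k T @^-1` B))
             - fine (m A) * fine (m B) * return_weight m T F k|)
        @[n --> within K \oo] --> (0 : R)]].

End InfiniteErgodicTheory.

(* Main.v *)
Require Import Defs.
From HB Require Import structures.
From mathcomp Require Import all_boot all_order all_algebra.
From mathcomp Require Import all_classical all_reals all_analysis.
From mathcomp Require Import measurable_realfun.
From mathcomp Require Import lra zify ring.
Set Implicit Arguments.
Unset Strict Implicit.
Unset Printing Implicit Defensive.
Import Order.TTheory GRing.Theory Num.Theory.
Import numFieldNormedType.Exports.
Local Open Scope classical_set_scope.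
Local Open Scope ring_scope.

(** Fix a state s and let v_k = p^(k)_ss / pi_s.  Call a set an s-block if it depends on
    the coordinates in a window at both ends of which the path sits at s.  By the Markov
    property m(C & T^-k C') = m(C) m(C') v_(k-h) for s-blocks C and C', where h is the
    delay due to their windows.  By recurrence every measurable subset of [s]_0 is
    approximated by finite disjoint unions of s-blocks, and a second moment bound turns
    an approximation of sets into an approximation of the sums over k < n of their
    correlations, uniformly in n.

    If v is smooth the delays do not matter, and F = [s]_0 works; conservativity and
    ergodicity then follow from the correlation asymptotics, since almost every path
    visits s.  Conversely, let F witness rational weak mixing and choose s with
    m(F & [s]_0) > 0.  An s-block C almost filled by F can be prolonged by r or by r + 1
    steps back to s (aperiodicity); comparing both correlation sequences with u(F)
    shows that v and its translate by one step are close. *)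

(** A small m(D) alone does not control sum_{k<n} m(D & T^-k C), which can grow like a_n = v_0 + ...
    + v_(n-1) with a constant not visibly tied to m(D). The squared number of visits to an s-block C
    before n, integrated over C, is however eventually at most of order m(C) (m(C) a_n)^2, again by
    the Markov property. A weighted AM-GM inequality then turns m(D) <= eta^2 m(C), for D inside C,
    into a bound of order eta m(C)^2 a_n. This square-root loss is why sets are approximated to
    precision eta^2. An error can sit in either set of a correlation, so visits are counted both
    forwards and backwards in time. In the converse the hypothesis is normalised by the unknown
    sequence a_n(F). Applied to F & [s]_0 itself it yields a_n(F) = O(a_n([s]_0)) along K, and only
    then can v be compared with u(F). *)

(** * Windows and uniqueness of measures on the two-sided sequence space *)

Section Windows.
Context {S : pointedType}.
Local Notation X := (bilateral S).
Implicit Types (x y : int -> S) (a b j c : int) (s t : S).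

Definition coord_set j s : set X := [set x | x j = s].

Definition window a b y : set X := [set x | forall j, a <= j <= b -> x j = y j].

Definition shiftz c (x : X) : X := fun j => x (j + c).

Lemma iter_shift k : iter k shift_map = shiftz k%:Z :> (X -> X).
Proof.
apply/funext => x; elim: k => [|k IH]; apply/funext => j; rewrite /shiftz ?addr0//.
by rewrite iterS IH /shift_map /shiftz; congr x; lia.
Qed.

Lemma window_cylinder a (n : nat) y :
  window a (a + n%:Z) y = cylinder n.+1 (fun i : nat => y (a - 1 + i%:Z)) (a - 1).
Proof.
apply/seteqP; split => x /= H j hj.
  by rewrite H; [congr y|]; lia.
have := H (absz (j - a + 1)%R); rewrite (_ : (absz (j - a + 1)%R)%:Z = j - a + 1); last lia.
by rewrite !(addrC _ (a - 1)) (_ : a - 1 + _ = j); [apply; lia|lia].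
Qed.

Lemma cylinder_measurable n (f : nat -> S) k : (0 < n)%N ->
  measurable (cylinder n f k : set X).
Proof. by move=> n0; apply: sub_sigma_algebra; exists n, f, k. Qed.

Lemma window_measurable a b y : a <= b -> measurable (window a b y).
Proof.
move=> ab; have [n ->] : exists n : nat, b = a + n%:Z by exists (absz (b - a)%R); lia.
by rewrite window_cylinder; exact: cylinder_measurable.
Qed.

Lemma coord_window j s : coord_set j s = window j j (fun=> s).
Proof.
apply/seteqP; split => x /=; last by apply; lia.
by move=> xj i ij; rewrite -xj; congr x; lia.
Qed.

Lemma coord_measurable j s : measurable (coord_set j s).
Proof. by rewrite coord_window; exact: window_measurable. Qed.

Lemma shiftz_window c a b y :
  shiftz c @^-1` window a b y = window (a + c) (b + c) (shiftz (- c) y).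
Proof.
apply/seteqP; split => x /= H j hj; rewrite /shiftz in H *.
  by rewrite -H; [congr x|]; lia.
by rewrite H; [congr y|]; lia.
Qed.

Lemma shiftz_coord c j s : shiftz c @^-1` coord_set j s = coord_set (j + c) s.
Proof. by []. Qed.

Lemma shiftz_comp c d A :
  shiftz c @^-1` (shiftz d @^-1` A) = shiftz (c + d) @^-1` A.
Proof.
rewrite (_ : shiftz (c + d) = shiftz d \o shiftz c) ?comp_preimage//.
by apply/funext => x; apply/funext => j; rewrite /shiftz /=; congr x; lia.
Qed.

Lemma shiftz0 A : shiftz 0 @^-1` A = A.
Proof.
rewrite (_ : shiftz 0 = id) ?preimage_id//; apply/funext => x.
by apply/funext => j; rewrite /shiftz addr0.
Qed.

Lemma bilateral_measurable_fun (f : X -> X) :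
  (forall j s, measurable (f @^-1` coord_set j s)) -> measurable_fun setT f.
Proof.
move=> mf; apply: (@measurability _ _ _ _ setT f (cylinders S)) => //.
move=> _ [_ [n [u [k [n0 ->]]]] <-]; rewrite setTI.
rewrite (_ : _ @^-1` _ =
  \bigcap_(j in [set j | (1 <= j <= n)%N]) (f @^-1` coord_set (j%:Z + k) (u j))); last first.
  by apply/seteqP; split => x /= H j hj; apply: H.
by apply: bigcap_measurable => [|j _]; [exists 1%N => /=; lia|exact: mf].
Qed.

Lemma shiftz_measurable_fun c : measurable_fun setT (shiftz c).
Proof. by apply: bilateral_measurable_fun => j s; rewrite shiftz_coord; exact: coord_measurable. Qed.

Lemma shiftz_measurable c (A : set X) : measurable A -> measurable (shiftz c @^-1` A).
Proof. by move=> mA; rewrite -[_ @^-1` _]setTI; exact: shiftz_measurable_fun. Qed.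

Hypothesis countS : countable [set: S].

(** Only countably many finite words occur on the intervals [-N, N]; the index codes [N] together
    with such a word, whose letters are written as naturals through an injection of S. *)
Lemma dense_sequence : exists e : nat -> int -> S,
  forall (N : nat) y, exists i, forall j, - N%:Z <= j <= N%:Z -> e i j = y j.
Proof.
have /countable_injP[f injf] := countS.
pose g (k : nat) : S := xget point [set s | f s = k].
have fK s : g (f s) = s.
  rewrite /g; case: xgetP => [u _ /= fu|/(_ s)/(_ erefl)//].
  by apply: injf; rewrite ?in_setE.
pose e (i : nat) (j : int) : S :=
  if (unpickle i : option (nat * seq nat)) is Some (N, w)
  then g (nth 0%N w (absz (j + (N : nat)%:Z)%R)) else point.
exists e => N y.
exists (pickle (N, [seq f (y (i%:Z - N%:Z)) | i <- iota 0 (N + N).+1])) => j hj.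
rewrite /e pickleK (nth_map 0%N); last by rewrite size_iota; lia.
by rewrite fK nth_iota; [congr y|]; lia.
Qed.

Lemma window_determined_bigcup (N : nat) (A : set X) :
  (forall x y, (forall j, - N%:Z <= j <= N%:Z -> x j = y j) -> A x -> A y) ->
  exists F : nat -> set X, A = \bigcup_i F i /\
    forall i, F i = set0 \/ exists y, F i = window (- N%:Z) N%:Z y.
Proof.
have [e eP] := dense_sequence => HA.
exists (fun i => if pselect (A (e i)) then window (- N%:Z) N%:Z (e i) else set0).
split=> [|i]; last by case: pselect => ?; [right; exists (e i)|left].
apply/seteqP; split => [x Ax|x [i _]].
  have [i ei] := eP N x; exists i => //.
  case: pselect => [_ j hj|nA]; first by rewrite ei.
  by apply: nA; apply: HA Ax => j hj; rewrite ei.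
case: pselect => [Ae wx|//].
by apply: (HA (e i)) => // j hj; rewrite wx.
Qed.

(** Symmetric windows are pairwise nested or disjoint, so together with the empty set they form a
    pi-system. The lower bound N on the radius lets later comparisons assume that a window covers a
    prescribed coordinate. *)
Lemma measure_eq_windows (R : realType) (N : nat)
    (m1 m2 : {measure set X -> \bar R}) :
  (forall n y, (N <= n)%N ->
     m1 (window (- n%:Z) n%:Z y) = m2 (window (- n%:Z) n%:Z y)) ->
  (forall y, (m1 (window (- N%:Z) N%:Z y) < +oo)%E) ->
  forall A, measurable A -> m1 A = m2 A.
Proof.
move=> m12 m1oo.
pose G : set (set X) := [set A | A = set0 \/
  exists n y, (N <= n)%N /\ A = window (- n%:Z) n%:Z y].
have [e eP] := dense_sequence.
apply: (@measure_unique _ R _ G (fun i => window (- N%:Z) N%:Z (e i))).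
- apply/seteqP; split; last first.
    apply: smallest_sub; first exact: sigma_algebra_measurable.
    move=> _ [->|[n [y [_ ->]]]]; first exact: measurable0.
    by apply: window_measurable; lia.
  apply: smallest_sub; first exact: smallest_sigma_algebra.
  move=> _ [n [u [k [n0 ->]]]].
  have [|F [-> FP]] := @window_determined_bigcup (N + n + `|k|)%N (cylinder n u k).
    by move=> x y xy H j hj; rewrite -xy ?H//; lia.
  have [_ _ cU] := smallest_sigma_algebra setT G; apply: cU => i.
  apply: sub_gen_smallest; have [->|[y ->]] := FP i; first by left.
  by right; exists (N + n + `|k|)%N, y; split => //; lia.
- move=> A B [->|[n [y [Nn ->]]]]; first by rewrite set0I; left.
  move=> [->|[n' [y' [Nn' ->]]]]; first by rewrite setI0; left.
  have [[x [wx w'x]]|/set0P/negP] := pselect (window (- n%:Z) n%:Z y `&` window (- n'%:Z) n'%:Z y' !=set0).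
    right; exists (maxn n n'), x; split; first by lia.
    apply/seteqP; split => [z [wz w'z] j hj|z wz].
      have [jn|jn] := leqP `|j|%N n; first by rewrite wz ?wx //; lia.
      by rewrite w'z ?w'x //; lia.
    by split => j hj; [rewrite wz ?wx|rewrite wz ?w'x] => //; lia.
  by rewrite negbK => /eqP ->; left.
- by move=> i; right; exists N, (e i).
- apply/seteqP; split => // x _; have [i ei] := eP N x; exists i => // j hj.
  by rewrite ei.
- by move=> _ [->|[n [y [Nn ->]]]]; [rewrite !measure0|exact: m12].
- by move=> k; exact: m1oo.
Qed.

End Windows.

(** Sums over states become series over a set of naturals, the form in which countable additivity
    applies. *)
Lemma esum_countable (R : realType) (S : pointedType) :
  countable [set: S] -> exists (D : set nat) (g : nat -> S),
    set_bij D setT g /\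
    forall a : S -> \bar R, (forall s, 0 <= a s)%E ->
    \esum_(s in [set: S]) a s = (\sum_(i <oo | i \in D) a (g i))%E.
Proof.
move=> /countable_injP[f injf].
pose g (k : nat) : S := xget point [set s | f s = k].
have fK s : g (f s) = s.
  rewrite /g; case: xgetP => [u _ /= fu|/(_ s)/(_ erefl)//].
  by apply: injf; rewrite ?in_setE.
exists (range f), g; have bg : set_bij (range f) setT g.
  split => //.
    by move=> _ _ /set_mem[s _ <-] /set_mem[t _ <-]; rewrite !fK => ->.
  by move=> s _; exists (f s); [exists s|].
split => // a a0; rewrite (reindex_esum (range f) setT g)//.
rewrite nneseries_esum; last by move=> n _; exact: a0.
by congr esum; apply/seteqP; split => x /=; rewrite in_setE.
Qed.

(** * Finite-measure estimates and a second moment bound *)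

Section FiniteMeasureTools.
Context {d : measure_display} {X : measurableType d} {R : realType}.
Variable m : {measure set X -> \bar R}.
Implicit Types (A B C D : set X).

Definition symdiff A B : set X := (A `\` B) `|` (B `\` A).

Lemma symdiff_measurable A B : measurable A -> measurable B -> measurable (symdiff A B).
Proof. by move=> mA mB; apply: measurableU; apply: measurableD. Qed.

Lemma fin_measure_sub A B : measurable A -> measurable B -> A `<=` B ->
  m B \is a fin_num -> m A \is a fin_num.
Proof.
move=> mA mB AB; rewrite !ge0_fin_numE ?measure_ge0//; apply: le_lt_trans.
by apply: le_measure; rewrite ?inE.
Qed.

Lemma fine_measure_ge0 A : 0 <= fine (m A).
Proof. exact/fine_ge0/measure_ge0. Qed.

Lemma fine_measure_le A B : measurable A -> measurable B -> A `<=` B ->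
  m B \is a fin_num -> fine (m A) <= fine (m B).
Proof.
move=> mA mB AB fB; apply: fine_le => //; first exact: fin_measure_sub fB.
by apply: le_measure; rewrite ?inE.
Qed.

Lemma fine_measureU A B : measurable A -> measurable B ->
  m A \is a fin_num -> m B \is a fin_num ->
  fine (m (A `|` B)) <= fine (m A) + fine (m B).
Proof.
move=> mA mB fA fB; rewrite -fineD//; apply: fine_le; rewrite ?fin_numD ?fA ?fB//.
  rewrite ge0_fin_numE ?measure_ge0//; apply: le_lt_trans (measureU2 _ mA mB) _.
  by rewrite ltey_eq fin_numD fA fB.
exact: measureU2.
Qed.

Lemma fine_measureDI A B : measurable A -> measurable B -> m A \is a fin_num ->
  fine (m A) = fine (m (A `\` B)) + fine (m (A `&` B)).
Proof.
move=> mA mB fA; rewrite -fineD; first by rewrite -measureDI.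
  by apply: fin_measure_sub fA => //; exact: measurableD.
by apply: fin_measure_sub fA => //; exact: measurableI.
Qed.

Lemma tail_small (C : nat -> set X) (F : set X) (e : R) : 0 < e ->
  (forall i, measurable (C i)) -> measurable F -> \bigcup_i C i `<=` F ->
  m F \is a fin_num ->
  exists n, fine (m (\bigcup_i C i `\` \bigcup_(i < n) C i)) <= e.
Proof.
move=> e0 mC mF CF fF.
have mU : measurable (\bigcup_i C i) by exact: bigcupT_measurable.
pose B n := \bigcup_i C i `\` \bigcup_(i < n) C i.
have mB n : measurable (B n).
  by apply: measurableD => //; apply: bigcup_measurable.
have fB n : m (B n) \is a fin_num.
  by apply: fin_measure_sub fF => // x [/CF].
have B0 : \bigcap_n B n = set0.
  apply/seteqP; split => // x H; have [[i _ Cx] _] := H 0%N I.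
  by have [_] := H i.+1 I; apply; exists i => //=.
have : (m \o B) n @[n --> \oo] --> m (\bigcap_n B n).
  apply: nonincreasing_cvg_mu => //; first by rewrite ltey_eq fB.
    by rewrite B0.
  move=> n k nk; apply/subsetPset => x [Ux nx]; split => // -[i /= ink Cx].
  by apply: nx; exists i => //=; exact: leq_trans nk.
rewrite B0 measure0 => /fine_cvgP[_ /cvgrPdist_le /(_ e e0)[n _ Hn]].
exists n; have := Hn n (leqnn n); rewrite /= sub0r normrN ger0_norm//.
Qed.

Lemma fine_measure_distance A B : measurable A -> measurable B ->
  m A \is a fin_num -> m B \is a fin_num ->
  `|fine (m A) - fine (m B)| <= fine (m (symdiff A B)).
Proof.
move=> mA mB fA fB.
have mAB := measurableD mA mB. have mBA := measurableD mB mA.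
have fAB : m (A `\` B) \is a fin_num by apply: fin_measure_sub fA => //; exact: subDsetl.
have fBA : m (B `\` A) \is a fin_num by apply: fin_measure_sub fB => //; exact: subDsetl.
have -> : fine (m (symdiff A B)) = fine (m (A `\` B)) + fine (m (B `\` A)).
  rewrite -fineD//; congr fine; apply: measureU => //.
  by apply/seteqP; split => // x [[] ? ? []].
rewrite (fine_measureDI mA mB)// (fine_measureDI mB mA)// setIC.
have := fine_measure_ge0 (A `\` B); have := fine_measure_ge0 (B `\` A).
by rewrite ler_norml => ? ?; lra.
Qed.

(* AM-GM, integrated over D: N <= l / 2 + N^2 / (2 l) for the counting function
   N of the sets E k. *)
Lemma sum_measure_second_moment n (E : nat -> set X) C D (l : R) : 0 < l ->
  measurable D -> measurable C -> D `<=` C -> m C \is a fin_num ->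
  (forall k, measurable (E k)) ->
  \sum_(0 <= k < n) fine (m (D `&` E k)) <=
    l / 2 * fine (m D) +
    (2 * l)^-1 * \sum_(0 <= i < n) \sum_(0 <= j < n) fine (m (C `&` E i `&` E j)).
Proof.
move=> l0 mD mC DC fC mE.
have fD : m D \is a fin_num by apply: fin_measure_sub fC.
have l20 : 0 <= l / 2 by lra.
have il0 : 0 <= (2 * l)^-1 by rewrite invr_ge0; lra.
have mDE k : measurable (D `&` E k) by exact: measurableI.
have fDE k : m (D `&` E k) \is a fin_num by apply: fin_measure_sub fD.
have mCE i j : measurable (C `&` E i `&` E j) by apply: measurableI => //; exact: measurableI.
have fCE i j : m (C `&` E i `&` E j) \is a fin_num.
  by apply: fin_measure_sub fC => // x [[]].
pose f x : \bar R := (\sum_(0 <= k < n) (\1_(D `&` E k) x)%:E)%E.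
pose g1 x : \bar R := ((l / 2)%:E * (\1_D x)%:E)%E.
pose h x : \bar R := (\sum_(0 <= i < n) \sum_(0 <= j < n) (\1_(C `&` E i `&` E j) x)%:E)%E.
pose g2 x : \bar R := ((2 * l)^-1%:E * h x)%E.
have mind A : measurable A -> measurable_fun setT (fun x => (\1_A x : R)%:E).
  by move=> mA; apply/measurable_EFinP; exact: measurable_indic.
have mf : measurable_fun setT f by apply: emeasurable_sum => k; exact: mind.
have mh : measurable_fun setT h.
  by apply: emeasurable_sum => i; apply: emeasurable_sum => j; exact: mind.
have mg1 : measurable_fun setT g1 by apply: emeasurable_funM; [exact: measurable_cst|exact: mind].
have mg2 : measurable_fun setT g2 by apply: emeasurable_funM; [exact: measurable_cst|exact: mh].
have f0 x : (0 <= f x)%E by apply: sume_ge0 => k _; rewrite lee_fin.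
have h0 x : (0 <= h x)%E by apply: sume_ge0 => i _; apply: sume_ge0 => j _; rewrite lee_fin.
have g10 x : (0 <= g1 x)%E by apply: mule_ge0; rewrite lee_fin.
have g20 x : (0 <= g2 x)%E by apply: mule_ge0; rewrite ?lee_fin.
have fg x : (f x <= g1 x + g2 x)%E.
  have hE : h x = (\sum_(0 <= i < n) \sum_(0 <= j < n) \1_(C `&` E i `&` E j) x)%:E.
    by rewrite /h -sumEFin; apply: eq_bigr => i _; rewrite sumEFin.
  rewrite /f /g1 /g2 hE sumEFin -!EFinM -EFinD lee_fin.
  have [Dx|Dx] := pselect (D x); last first.
    rewrite big1 => [|k _]; last by rewrite indicE memNset// => -[].
    by rewrite addr_ge0// mulr_ge0// sumr_ge0// => i _; rewrite sumr_ge0.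
  have Cx := DC _ Dx.
  pose N := \sum_(0 <= k < n) (\1_(E k) x : R).
  have -> : \sum_(0 <= k < n) \1_(D `&` E k) x = N.
    by apply: eq_bigr => k _; rewrite indicI /= !indicE (mem_set Dx) mul1r.
  have -> : \sum_(0 <= i < n) \sum_(0 <= j < n) \1_(C `&` E i `&` E j) x = N * N.
    rewrite /N mulr_suml; apply: eq_bigr => i _; rewrite mulr_sumr.
    by apply: eq_bigr => j _; rewrite !indicI /= !indicE (mem_set Cx) mul1r.
  rewrite indicE (mem_set Dx) mulr1.
  have -> : l / 2 + (2 * l)^-1 * (N * N) = N + (2 * l)^-1 * (N - l) ^+ 2.
    by field; rewrite gt_eqF.
  by rewrite lerDl mulr_ge0// sqr_ge0.
have : (\int[m]_x f x <= \int[m]_x (g1 x + g2 x))%E.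
  apply: ge0_le_integral => //; exact: emeasurable_funD.
have If : (\int[m]_x f x = (\sum_(0 <= k < n) fine (m (D `&` E k)))%:E)%E.
  rewrite /f ge0_integral_sum//; last by move=> k; exact: mind.
  rewrite -sumEFin; apply: eq_bigr => k _.
  by rewrite integral_indic// setIT fineK.
have Ih : (\int[m]_x h x = (\sum_(0 <= i < n) \sum_(0 <= j < n) fine (m (C `&` E i `&` E j)))%:E)%E.
  rewrite /h ge0_integral_sum//.
  - rewrite -sumEFin; apply: eq_bigr => i _.
    rewrite ge0_integral_sum//; last by move=> j; exact: mind.
    rewrite -sumEFin; apply: eq_bigr => j _.
    by rewrite integral_indic// setIT fineK.
  - by move=> i; apply: emeasurable_sum => j; exact: mind.
  - by move=> i x _; apply: sume_ge0 => j _; rewrite lee_fin.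
have I1 : (\int[m]_x g1 x = (l / 2 * fine (m D))%:E)%E.
  rewrite /g1 ge0_integralZl//; last exact: mind.
  by rewrite integral_indic// setIT (EFinM (l / 2)) fineK.
have I2 : (\int[m]_x g2 x = (2 * l)^-1%:E * \int[m]_x h x)%E.
  by rewrite /g2 ge0_integralZl.
by rewrite ge0_integralD// I1 I2 Ih If -EFinM -EFinD lee_fin.
Qed.

End FiniteMeasureTools.

(** * Approximation by sets that depend on finitely many coordinates *)

Section WindowApproximation.
Context {R : realType} {S : pointedType}.
Local Notation X := (bilateral S).
Variable m : {measure set X -> \bar R}.
Implicit Types (x y : int -> S) (A B U F : set X).

Definition window_set (N : nat) U :=
  forall x y, (forall j, - N%:Z <= j <= N%:Z -> x j = y j) -> U x -> U y.

Lemma window_set_le N N' U : (N <= N')%N -> window_set N U -> window_set N' U.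
Proof. by move=> NN' wU x y xy; apply: wU => j hj; apply: xy; lia. Qed.

(** The approximable sets form a sigma-algebra containing the cylinders. Errors are measured inside
    F only, since m may be infinite while complements and countable unions must stay
    approximable. *)
Lemma window_approx F A (e : R) : measurable F -> m F \is a fin_num ->
  measurable A -> 0 < e ->
  exists N U, [/\ measurable U, window_set N U & fine (m (F `&` symdiff A U)) <= e].
Proof.
move=> mF fF mA; move: e.
pose L : set (set X) := [set A | measurable A /\ forall e : R, 0 < e ->
  exists N U, [/\ measurable U, window_set N U & fine (m (F `&` symdiff A U)) <= e]].
have fsub B : measurable B -> m (F `&` B) \is a fin_num.
  by move=> mB; apply: fin_measure_sub fF => //; exact: measurableI.
suff LA : measurable `<=` L by have [] := LA _ mA.
have Lbig (B : nat -> set X) : (forall n, L (B n)) -> L (\bigcup_k B k).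
  move=> LB; have mB n : measurable (B n) by have [] := LB n.
  have mU : measurable (\bigcup_k B k) by exact: bigcupT_measurable.
  split => // e e0; have e20 : 0 < e / 2 by lra.
  have mFB k : measurable (F `&` B k) by exact: measurableI.
  have [n Hn] := @tail_small _ _ _ m (fun k => F `&` B k) F (e / 2) e20 mFB mF
    (@bigcup_sub _ _ _ _ _ (fun k _ => @subIsetl _ _ _)) fF.
  have {}Hn : fine (m (F `&` (\bigcup_k B k `\` \bigcup_(k < n) B k))) <= e / 2.
    rewrite -!setI_bigcupr in Hn; rewrite setIDA.
    rewrite (_ : _ `\` _ = F `&` \bigcup_k B k `\` F `&` \bigcup_(k < n) B k)//.
    apply/seteqP; split => x [[Fx Bx] nB]; split => //; first by move=> [].
    by move=> Bx'; apply: nB.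
  have [N [U [mU' wU Ue]]] : exists N U, [/\ measurable U, window_set N U &
      fine (m (F `&` symdiff (\bigcup_(k < n) B k) U)) <= e / 2].
    elim: n (e / 2) e20 {Hn} => [|n IH] e1 e10.
      exists 0%N, set0; split => //.
      by rewrite bigcup_mkord big_ord0 /symdiff setDv setU0 setI0 measure0 ltW.
    have e120 : 0 < e1 / 2 by lra.
    have [N1 [U1 [mU1 wU1 Ue1]]] := IH _ e120.
    have [N2 [U2 [mU2 wU2 Ue2]]] := (LB n).2 _ e120.
    exists (maxn N1 N2), (U1 `|` U2); split; first exact: measurableU.
      move=> x y xy [H|H]; [left|right].
        by apply: (window_set_le (leq_maxl N1 N2) wU1) H.
      by apply: (window_set_le (leq_maxr N1 N2) wU2) H.
    have mBn : measurable (\bigcup_(k < n) B k) by exact: bigcup_measurable.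
    have mBn1 : measurable (\bigcup_(k < n.+1) B k) by exact: bigcup_measurable.
    have m1 : measurable (F `&` symdiff (\bigcup_(k < n) B k) U1).
      by apply: measurableI => //; exact: symdiff_measurable.
    have m2 : measurable (F `&` symdiff (B n) U2).
      by apply: measurableI => //; exact: symdiff_measurable.
    have f1 : m (F `&` symdiff (\bigcup_(k < n) B k) U1) \is a fin_num.
      by apply: fsub; exact: symdiff_measurable.
    have f2 : m (F `&` symdiff (B n) U2) \is a fin_num.
      by apply: fsub; exact: symdiff_measurable.
    apply: (@le_trans _ _ (fine (m (F `&` symdiff (\bigcup_(k < n) B k) U1 `|` F `&` symdiff (B n) U2)))).
      apply: fine_measure_le.
      - by apply: measurableI => //; apply: symdiff_measurable => //; exact: measurableU.
      - exact: measurableU.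
      - rewrite !bigcup_mkord big_ord_recr /= -setIUr; apply: setIS.
        move=> x [[[Bx|Bx] nU]|[[Ux|Ux] nB]].
        + by left; left; split => // Ux; apply: nU; left.
        + by right; left; split => // Ux; apply: nU; right.
        + by left; right; split => // Bx; apply: nB; left.
        + by right; right; split => // Bx; apply: nB; right.
      - by rewrite -setIUr; apply: fsub; apply: measurableU; exact: symdiff_measurable.
    apply: le_trans (fine_measureU m1 m2 f1 f2) _; lra.
  exists N, U; split => //.
  have mBn : measurable (\bigcup_(k < n) B k) by exact: bigcup_measurable.
  have m1 : measurable (F `&` (\bigcup_k B k `\` \bigcup_(k < n) B k)).
    by apply: measurableI => //; exact: measurableD.
  have m2 : measurable (F `&` symdiff (\bigcup_(k < n) B k) U).
    by apply: measurableI => //; exact: symdiff_measurable.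
  have f1 : m (F `&` (\bigcup_k B k `\` \bigcup_(k < n) B k)) \is a fin_num.
    by apply: fsub; exact: measurableD.
  have f2 : m (F `&` symdiff (\bigcup_(k < n) B k) U) \is a fin_num.
    by apply: fsub; exact: symdiff_measurable.
  apply: (@le_trans _ _ (fine (m (F `&` (\bigcup_k B k `\` \bigcup_(k < n) B k) `|`
      F `&` symdiff (\bigcup_(k < n) B k) U)))).
    apply: fine_measure_le.
    - by apply: measurableI => //; exact: symdiff_measurable.
    - exact: measurableU.
    - rewrite -setIUr; apply: setIS => x [[Bx nU]|[Ux nB]].
        have [Bnx|nBn] := pselect ((\bigcup_(k < n) B k) x); first by right; left.
        by left.
      right; right; split => // -[k _ Bk]; apply: nB; by exists k.
    - rewrite -setIUr; apply: fsub; apply: measurableU; first exact: measurableD.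
      exact: symdiff_measurable.
  by apply: le_trans (fine_measureU m1 m2 f1 f2) _; lra.
apply: smallest_sub.
  split.
  - split=> // e e0; exists 0%N, set0; split => //.
    by rewrite /symdiff setDv setU0 setI0 measure0 ltW.
  - move=> B [mB LB]; split; first exact: measurableD.
    move=> e /LB[N [U [mU wU Ue]]]; exists N, (~` U); split.
    + exact: measurableC.
    + by move=> x y xy nU Uy; apply: nU; apply: wU Uy => j hj; rewrite xy.
    + rewrite (_ : symdiff _ _ = symdiff (B : set X) U)//.
      apply/seteqP; split => [x [[[_ nB] /contrapT Ux]|[nU]]|x [[Bx nU]|[Ux nB]]].
      * by right.
      * by move=> H; left; split => //; apply: contrapT => nB; apply: H.
      * by right; split => // -[].
      * by left; split => // /(_ Ux).
  - exact: Lbig.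
move=> _ [n [u [k [n0 ->]]]]; split; first exact: cylinder_measurable.
move=> e e0; exists (n + `|k|)%N, (cylinder n u k); split.
- exact: cylinder_measurable.
- by move=> x y xy H j hj; rewrite -xy ?H//; lia.
- by rewrite /symdiff setDv setU0 setI0 measure0 ltW.
Qed.

End WindowApproximation.

(** * Limits along K, shifted differences, and semigroups with gcd 1 *)

Lemma cvg_within0 (R : realType) (K : set nat) (f : nat -> R) :
  (f n @[n --> within K \oo] --> (0 : R)) <->
  (forall e, 0 < e -> exists N, forall n, (N <= n)%N -> K n -> `|f n| <= e).
Proof.
split=> [/cvgrPdist_le H e e0|H].
  have [N _ HN] := H e e0; exists N => n Nn Kn.
  by have := HN n Nn Kn; rewrite /= sub0r normrN.
apply/cvgrPdist_le => e e0; have [N HN] := H e e0; exists N => // n /= Nn Kn.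
by rewrite sub0r normrN; exact: HN.
Qed.

(** Telescoping: each of the h unit steps contributes a translate of the variation, and the range n
    + h contains all these translates. *)
Lemma shift_diff_sum (R : realType) (f : nat -> R) h n :
  \sum_(0 <= k < n) `|f k - f (k + h)%N| <=
  h%:R * \sum_(0 <= k < n + h) `|f k - f k.+1|.
Proof.
elim: h => [|h IH].
  rewrite mul0r big1 // => k _; by rewrite addn0 subrr normr0.
have le1 : \sum_(0 <= k < n + h) `|f k - f k.+1| <= \sum_(0 <= k < n + h.+1) `|f k - f k.+1|.
  by rewrite addnS big_nat_recr//= lerDl.
apply: (@le_trans _ _ (\sum_(0 <= k < n) (`|f k - f (k + h)%N| + `|f (k + h)%N - f (k + h).+1|))).
  apply: ler_sum => k _; rewrite addnS.
  by rewrite -[X in `|X|](subrKA (f (k + h)%N)); exact: ler_normD.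
rewrite big_split /= -natr1 mulrDl mul1r; apply: lerD.
  by apply: le_trans IH _; rewrite ler_wpM2l.
apply: le_trans le1; rewrite [leRHS](@big_cat_nat _ _ _ h) ?leq_addl//=.
have := @big_addn R 0 +%R 0%N (n + h) h xpredT (fun k => `|f k - f k.+1|).
by rewrite add0n addnK => ->; rewrite lerDr sumr_ge0.
Qed.

(** The least positive difference d between two members of A divides every member a: a positive
    remainder of a modulo d would be a smaller difference. *)
Lemma consecutive_of_gcd1 (A : set nat) : (exists n, A n) ->
  (forall i j, A i -> A j -> A (i + j)%N) -> is_gcd_of A 1 ->
  exists n, A n /\ A n.+1.
Proof.
move=> [a0 Aa0] addA [_ gcdA].
have mulA k n : A n -> A (k.+1 * n)%N.
  by move=> An; elim: k => [|k IH]; [rewrite mul1n|rewrite mulSn; exact: addA].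
pose Q d := `[< (0 < d)%N /\ exists n, A n /\ A (n + d)%N >].
have exQ : exists d, Q d.
  have [a00|a00] := posnP a0; last first.
    exists a0; apply/asboolP; split => //; exists a0; split => //; exact: addA.
  apply: contrapT => nQ; suff : (0 %| 1)%N by [].
  apply: gcdA => n An; rewrite dvd0n; apply: contrapT => /negP n0; apply: nQ.
  exists n; apply/asboolP; split; first by rewrite lt0n.
  by exists n; split => //; exact: addA.
case: (ex_minnP exQ) => d /asboolP[d0 [n [An And]]] dmin.
suff d1 : d = 1%N by exists n; rewrite -addn1 -d1.
apply/eqP; rewrite -dvdn1; apply: gcdA => a Aa.
apply: contrapT => /negP; rewrite /dvdn -lt0n => r0.
have : (d <= a %% d)%N.
  apply: dmin; apply/asboolP; split => //.
  set q := (a %/ d)%N.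
  (* With a = q d + r, the members q (n + d) + n and a + (q + 1) n differ by exactly r. *)
  exists (q * (n + d) + n)%N; split.
    have [->|q0] := posnP q; first by rewrite mul0n.
    by apply: addA => //; rewrite -(prednK q0); exact: mulA.
  rewrite (_ : q * (n + d) + n + a %% d = a + q.+1 * n)%N; first by apply: addA => //; exact: mulA.
  by have := divn_eq a d; rewrite -/q mulnDr mulSn; lia.
by rewrite leqNgt ltn_pmod.
Qed.

Section MarkovShift.
Context {R : realType} {S : pointedType}.
Hypothesis countS : countable [set: S].
Variables (P : S -> S -> R) (pi : S -> R).
Hypothesis P_stoch : stochastic P.
Hypothesis pi_ge0 : forall s, 0 <= pi s.
Variable m : {measure set (bilateral S) -> \bar R}.
Hypothesis m_markov : markov_measure P pi m.
Local Notation X := (bilateral S).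
Local Notation mf A := (fine (m A)).
Local Notation "A '@-' k" := (shiftz k%:Z @^-1` A) (at level 20).

Let P_ge0 u v : 0 <= P u v.
Proof. by have /andP[] := P_stoch.1 u v. Qed.

(** * Mass of two windows separated by a gap; stationarity *)

Section GapFormula.
Implicit Types (x y : int -> S) (a b i j c : int) (s t : S).

Definition path_weight a (n : nat) y : R :=
  \prod_(0 <= k < n) P (y (a + k%:Z)) (y (a + k.+1%:Z)).

Lemma path_weight_ge0 a n y : 0 <= path_weight a n y.
Proof. exact: prodr_ge0. Qed.

Lemma mpow_ge0 n s t : (0 <= mpow P n s t)%E.
Proof.
case: n => [|n] /=; first by rewrite lee_fin.
apply: esum_ge0 => u _; apply: mule_ge0; first by rewrite lee_fin.
by elim: n u => [|n IH] u /=; [rewrite lee_fin|apply: esum_ge0 => v _; apply: mule_ge0; rewrite ?lee_fin].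
Qed.

Lemma m_window a (n : nat) y :
  m (window a (a + n%:Z) y) = (pi (y a) * path_weight a n y)%:E.
Proof.
rewrite window_cylinder m_markov//; congr (_ * _)%:E.
  by congr pi; congr y; lia.
rewrite /path_weight big_add1 /=; apply: eq_bigr => k _.
by congr P; congr y; lia.
Qed.

Lemma m_coord j s : m (coord_set j s) = (pi s)%:E.
Proof.
rewrite coord_window -[X in window _ X]addr0 (m_window j 0).
by rewrite /path_weight big_geq // mulr1.
Qed.

Lemma measure_split j (E : set X) : measurable E ->
  m E = \esum_(t in [set: S]) m (E `&` coord_set j t).
Proof.
move=> mE; have [D [g [[_ gi gs] ->]]] := esum_countable R countS; last first.
  by move=> s; exact: measure_ge0.
rewrite -measure_bigcup; last 2 first.
- by move=> i _; apply: measurableI => //; exact: coord_measurable.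
- move=> k l Dk Dl [x [[_ /= xk] [_ /= xl]]].
  by apply: gi; rewrite ?in_setE // -xk -xl.
rewrite -setI_bigcupr setIidl// => x _.
by have [k Dk gk] := gs (x j) I; exists k.
Qed.

Lemma esumZl (k : R) (f : S -> \bar R) : 0 <= k -> (forall s, 0 <= f s)%E ->
  \esum_(s in [set: S]) (k%:E * f s)%E = (k%:E * \esum_(s in [set: S]) f s)%E.
Proof.
move=> k0 f0; have [D [g [_ H]]] := esum_countable R countS.
rewrite !H//; last by move=> s; apply: mule_ge0; rewrite ?lee_fin.
by rewrite nneseriesZl// => i _.
Qed.

(** Induction on the gap: summing over the state just after the left window prolongs that window by
    one step and shortens the gap by one. At gap 0 the windows share the coordinate b and either
    glue or are incompatible. *)
Lemma m_gap (g n n' : nat) a b y y' : b = a + n%:Z + g%:Z ->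
  m (window a (a + n%:Z) y `&` window b (b + n'%:Z) y') =
  ((pi (y a) * path_weight a n y)%:E * mpow P g (y (a + n%:Z)%R) (y' b)
     * (path_weight b n' y')%:E)%E.
Proof.
elim: g n y => [|g IH] n y bE.
  have {}bE : b = a + n%:Z by lia.
  rewrite -bE /=; have [yb|yb] := eqVneq; last first.
    rewrite mule0 mul0e; apply/eqP; rewrite (_ : _ `&` _ = set0) ?measure0//.
    apply/seteqP; split => // x [w w']; move/eqP: yb; apply.
    by rewrite -w -?w'//; lia.
  pose z j := if j <= b then y j else y' j.
  rewrite (_ : _ `&` _ = window a (a + (n + n')%N%:Z) z).
    rewrite m_window mule1 -EFinM -mulrA; congr (_ * _)%:E.
      by congr pi; rewrite /z ifT//; lia.
    rewrite /path_weight (@big_cat_nat _ _ _ n)//=; last by lia.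
    congr *%R; first by apply: eq_big_nat => k kn; rewrite /z !ifT//; lia.
    rewrite -{1}[n]addn0 addnC big_addn addKn.
    apply: eq_big_nat => k kn.
    have zE (l : nat) : z (a + (l + n)%N%:Z) = y' (b + l%:Z).
      have [->|l0] := eqVneq l 0%N; first by rewrite addr0 add0n -bE -yb /z ifT//; lia.
      by rewrite /z ifF; [congr y'|]; lia.
    by rewrite -addSn !zE.
  apply/seteqP; split => [x [w w'] j hj|x w].
    by rewrite /z; case: ifP => hb; [rewrite w|rewrite w'] => //; lia.
  split => j hj; rewrite w /z; try lia; first by rewrite ifT//; lia.
  by case: ifP => // jb; rewrite (_ : j = b)//; lia.
have mI : measurable (window a (a + n%:Z) y `&` window b (b + n'%:Z) y' : set X).
  by apply: measurableI; apply: window_measurable; lia.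
rewrite (measure_split (a + n.+1%:Z))//=.
transitivity (\esum_(u in [set: S]) ((pi (y a) * path_weight a n y * path_weight b n' y')%:E
   * ((P (y (a + n%:Z)%R) u)%:E * mpow P g u (y' b)))%E).
  apply: eq_esum => u _.
  pose yu j := if j == a + n.+1%:Z then u else y j.
  have yuE : yu (a + n.+1%:Z) = u by rewrite /yu eqxx.
  have yua : yu a = y a by rewrite /yu ifF//; lia.
  rewrite (_ : _ `&` _ `&` _ = window a (a + n.+1%:Z) yu `&` window b (b + n'%:Z) y'); last first.
    rewrite setIAC; congr (_ `&` _); apply/seteqP; split => [x [w /= xu] j hj|x w].
      by rewrite /yu; case: eqP => [->//|?]; rewrite w//; lia.
    split => [j hj|]; last by rewrite /coord_set /mkset -yuE; apply: w; lia.
    by rewrite w /yu ?ifF//; lia.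
  rewrite IH; last by lia.
  rewrite yua yuE.
  rewrite (_ : path_weight a n.+1 yu = path_weight a n y * P (y (a + n%:Z)) u); last first.
    rewrite /path_weight big_nat_recr//= yuE; congr (_ * P _ _); last by rewrite /yu ifF//; lia.
    by apply: eq_big_nat => k kn; rewrite /yu !ifF//; lia.
  rewrite mulrA !EFinM.
  by rewrite -!muleA; do 2 congr mule; rewrite muleA muleC.
rewrite esumZl; last 2 first.
- by rewrite !mulr_ge0// path_weight_ge0.
- by move=> u; apply: mule_ge0; rewrite ?lee_fin// mpow_ge0.
by rewrite !EFinM -!muleA; do 2 congr mule; rewrite muleC.
Qed.

Lemma push_eq (N : nat) (m1 m2 : {measure set X -> \bar R}) (f g : X -> X) :
  measurable_fun setT f -> measurable_fun setT g ->
  (forall n y, (N <= n)%N -> let W := window (- n%:Z) n%:Z y in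
     m1 (f @^-1` W) = m2 (g @^-1` W)) ->
  (forall y, (m1 (f @^-1` window (- N%:Z) N%:Z y) < +oo)%E) ->
  forall A, measurable A -> m1 (f @^-1` A) = m2 (g @^-1` A).
Proof.
move=> mf mg fg foo.
apply: (@measure_eq_windows _ countS _ N
  (measure_function_pushforward__canonical__measure_function_Measure m1 mf)
  (measure_function_pushforward__canonical__measure_function_Measure m2 mg)) => //.
Qed.

Lemma m_symwindow (n : nat) y : m (window (- n%:Z) n%:Z y) =
  (pi (y (- n%:Z)) * path_weight (- n%:Z) (n + n) y)%:E.
Proof. by rewrite -m_window; congr (m (window _ _ _)); lia. Qed.

(** The mass of a window does not depend on its position, and windows determine the measure. *)
Lemma m_shift c (A : set X) : measurable A -> m (shiftz c @^-1` A) = m A.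
Proof.
apply: (@push_eq 0 m m (shiftz c) id) => //.
- exact: shiftz_measurable_fun.
- move=> n y _ /=; rewrite shiftz_window preimage_id m_symwindow.
  rewrite (_ : n%:Z + c = - n%:Z + c + (n + n)%N%:Z); last lia.
  rewrite m_window; congr (pi _ * _)%:E; first by rewrite /shiftz; congr y; lia.
  by apply: eq_bigr => k _; rewrite /shiftz; congr P; congr y; lia.
- move=> y; rewrite shiftz_window -[X in window _ X]addr0 (_ : 0%:Z + c + 0 = - 0%:Z + c + 0%:Z); last lia.
  by rewrite m_window ltry.
Qed.

End GapFormula.

(** * The Markov property for general events of the past and the future *)

Section MarkovProperty.
Implicit Types (x y : int -> S) (a b i j c : int) (s t : S) (E G : set X).

Lemma mpow_le1 n s t : (mpow P n s t <= 1)%E.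
Proof.
elim: n s => [|n IH] s /=; first by rewrite lee_fin; case: eqVneq.
rewrite -(P_stoch.2 s); apply: le_esum => u _.
by rewrite -[leRHS]mule1; apply: lee_wpmul2l; rewrite ?lee_fin.
Qed.

Lemma mpow_fin n s t : mpow P n s t \is a fin_num.
Proof.
rewrite ge0_fin_numE ?mpow_ge0//; apply: le_lt_trans (mpow_le1 n s t) _.
exact: ltry.
Qed.

Definition past i E := forall x y, (forall j, j <= i -> x j = y j) -> E x -> E y.
Definition future i E := forall x y, (forall j, i <= j -> x j = y j) -> E x -> E y.

Lemma m_sub_coord j s E : measurable E -> E `<=` coord_set j s -> m E \is a fin_num.
Proof.
move=> mE Es; rewrite ge0_fin_numE ?measure_ge0//.
apply: (@le_lt_trans _ _ (pi s)%:E); last by rewrite ltry.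
rewrite -(m_coord j); apply: le_measure => //; rewrite ?inE//.
exact: coord_measurable.
Qed.

(** [m_gap] settles the case of a window G. Restricted to x_j = t, both sides are measures in G, so
    windows suffice. The factor pi t stands on the left to avoid dividing by a mass that may
    vanish. *)
Let markov_window g n a j y t G : j = a + n%:Z + g%:Z ->
  measurable G -> future j G -> G `<=` coord_set j t ->
  ((pi t)%:E * m (window a (a + n%:Z)%R y `&` G) =
   m (window a (a + n%:Z)%R y) * mpow P g (y (a + n%:Z)%R) t * m G)%E.
Proof.
move=> jE mG fG Gt.
set E := window a _ y; have mE : measurable (E : set X) by apply: window_measurable; lia.
(* Freezing the coordinates before j at x_j fixes every event of the future of j. Inside x_j = t, it
   turns a large symmetric window into the empty set or a window starting at j. *)
pose f (x : X) : X := fun l => x (Num.max l j).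
have mf : measurable_fun setT f.
  apply: bilateral_measurable_fun => l u.
  rewrite (_ : _ @^-1` _ = coord_set (Num.max l j) u)//; exact: coord_measurable.
have fGE : f @^-1` G = G.
  by apply/seteqP; split => x; apply: fG => l jl; rewrite /f max_l.
have mt : measurable (coord_set j t : set X) by exact: coord_measurable.
have mEt : measurable (E `&` coord_set j t) by exact: measurableI.
have mEfin : m E \is a fin_num by rewrite m_window fin_numE.
have c0 : 0 <= fine (m E * mpow P g (y (a + n%:Z)%R) t)%E.
  by apply: fine_ge0; apply: mule_ge0; rewrite ?measure_ge0// mpow_ge0.
pose m1 : {measure set X -> \bar R} := mscale (NngNum (pi_ge0 t)) (mrestr m mEt).
pose m2 : {measure set X -> \bar R} := mscale (NngNum c0) (mrestr m mt).
have m1E A : m1 A = ((pi t)%:E * m (A `&` (E `&` coord_set j t)))%E by [].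
have m2E A : m2 A = ((fine (m E * mpow P g (y (a + n%:Z)%R) t))%:E * m (A `&` coord_set j t))%E by [].
have : m1 (f @^-1` G) = m2 (f @^-1` G).
  apply: (push_eq (N := `|j|%N) (m1 := m1) (m2 := m2) mf mf) => //.
    move=> k y' jk W.
    rewrite m1E m2E.
    have [[x [Wx xt]]|/set0P/negP] := pselect (f @^-1` W `&` coord_set j t !=set0); last first.
      rewrite negbK => /eqP W0.
      by rewrite (setIC E) setIA W0 set0I measure0 !mule0.
    have yt l : - k%:Z <= l <= j -> y' l = t.
      by move=> hl; rewrite -Wx ?/f ?max_r//; lia.
    have [k' kE] : exists k' : nat, k%:Z = j + k'%:Z by exists (absz (k%:Z - j)%R); lia.
    have -> : f @^-1` W `&` coord_set j t = window j (j + k'%:Z) y'.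
      apply/seteqP; split => [z [Wz /= zt] l hl|z Wz].
        by rewrite -Wz ?/f ?max_l//; lia.
      split => [l hl|]; last by rewrite /coord_set /= -(yt j); [apply: Wz|]; lia.
      have [jl|lj] := leP j l; first by rewrite /f max_l ?Wz//; lia.
      by rewrite /f max_r ?Wz ?yt//; lia.
    rewrite (setIC E) setIA.
    have -> : f @^-1` W `&` coord_set j t `&` E = E `&` window j (j + k'%:Z) y'.
      rewrite setIC; congr (_ `&` _).
      apply/seteqP; split => [z [Wz /= zt] l hl|z Wz].
        by rewrite -Wz ?/f ?max_l//; lia.
      split => [l hl|]; last by rewrite /coord_set /= -(yt j); [apply: Wz|]; lia.
      have [jl|lj] := leP j l; first by rewrite /f max_l ?Wz//; lia.
      by rewrite /f max_r ?Wz ?yt//; lia.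
    rewrite (m_gap (g := g))//.
    rewrite !m_window fineK ?fin_numM ?mpow_fin// yt; last by lia.
    by rewrite [in RHS](EFinM (pi t)) [RHS]muleCA.
  move=> y'; rewrite m1E.
  have mf' : m (f @^-1` window (- `|j|%N%:Z) `|j|%N%:Z y' `&` (E `&` coord_set j t)) \is a fin_num.
    apply: (@m_sub_coord j t); last by move=> x [_ []].
    apply: measurableI => //; rewrite -[X in measurable X]setTI; apply: mf => //.
    by apply: window_measurable; lia.
  by rewrite ltey_eq fin_numM.
rewrite fGE m1E m2E (setIidl Gt) fineK; last by rewrite fin_numM ?mpow_fin.
by rewrite (setIC E) setIA (setIidl Gt) setIC.
Qed.

(** The window on the left is replaced by an arbitrary event of the past, by the same uniqueness
    argument with G held fixed and the coordinates after i frozen at x_i. *)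
Lemma markov_property (g : nat) i j s t E G : j = i + g%:Z ->
  measurable E -> measurable G -> past i E -> future j G ->
  E `<=` coord_set i s -> G `<=` coord_set j t ->
  ((pi t)%:E * m (E `&` G) = m E * mpow P g s t * m G)%E.
Proof.
move=> jE mE mG pE fG Es Gt.
pose f (x : X) : X := fun l => x (Num.min l i).
have mf : measurable_fun setT f.
  apply: bilateral_measurable_fun => l u.
  rewrite (_ : _ @^-1` _ = coord_set (Num.min l i) u)//; exact: coord_measurable.
have fEE : f @^-1` E = E.
  by apply/seteqP; split => x; apply: pE => l jl; rewrite /f min_l.
have ms : measurable (coord_set i s : set X) by exact: coord_measurable.
have mGs : measurable (coord_set i s `&` G) by exact: measurableI.
have mGfin : m G \is a fin_num by apply: m_sub_coord Gt.
have c0 : 0 <= fine (mpow P g s t * m G)%E.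
  by apply: fine_ge0; apply: mule_ge0; rewrite ?measure_ge0// mpow_ge0.
pose m1 : {measure set X -> \bar R} := mscale (NngNum (pi_ge0 t)) (mrestr m mGs).
pose m2 : {measure set X -> \bar R} := mscale (NngNum c0) (mrestr m ms).
have m1E A : m1 A = ((pi t)%:E * m (A `&` (coord_set i s `&` G)))%E by [].
have m2E A : m2 A = ((fine (mpow P g s t * m G))%:E * m (A `&` coord_set i s))%E by [].
have : m1 (f @^-1` E) = m2 (f @^-1` E).
  apply: (push_eq (N := `|i|%N) (m1 := m1) (m2 := m2) mf mf) => //.
    move=> k y' ik W.
    rewrite m1E m2E setIA.
    have [[x [Wx xs]]|/set0P/negP] := pselect (f @^-1` W `&` coord_set i s !=set0); last first.
      by rewrite negbK => /eqP ->; rewrite set0I measure0 !mule0.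
    have ys l : i <= l <= k%:Z -> y' l = s.
      by move=> hl; rewrite -Wx ?/f ?min_r//; lia.
    have [k' kE] : exists k' : nat, i = - k%:Z + k'%:Z by exists (absz (i + k%:Z)%R); lia.
    have -> : f @^-1` W `&` coord_set i s = window (- k%:Z) (- k%:Z + k'%:Z) y'.
      apply/seteqP; split => [z [Wz /= zt] l hl|z Wz].
        by rewrite -Wz ?/f ?min_l//; lia.
      split => [l hl|]; last by rewrite /coord_set /= -(ys i); [apply: Wz|]; lia.
      have [il|li] := leP i l; last by rewrite /f min_l ?Wz//; lia.
      by rewrite /f min_r ?Wz ?ys//; lia.
    rewrite (@markov_window g _ _ j)//; last by lia.
    rewrite fineK ?fin_numM ?mpow_fin// ys; last by lia.
    by rewrite -muleA muleC.
  move=> y'; rewrite m1E.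
  have mf' : m (f @^-1` window (- `|i|%N%:Z) `|i|%N%:Z y' `&` (coord_set i s `&` G)) \is a fin_num.
    apply: (@m_sub_coord j t); last by move=> x [_ []] _ /Gt.
    apply: measurableI => //; rewrite -[X in measurable X]setTI; apply: mf => //.
    by apply: window_measurable; lia.
  by rewrite ltey_eq fin_numM.
rewrite fEE m1E m2E setIA (setIidl Es) fineK; last by rewrite fin_numM ?mpow_fin.
by move=> ->; rewrite muleC muleA.
Qed.

End MarkovProperty.

(** * Positive return probabilities and aperiodicity *)

Lemma mpow_path n s t :
  (0 < mpow P n.+1 s t)%E ->
  exists u, (0 < (P s u)%:E * mpow P n u t)%E.
Proof.
move=> H; apply: contrapT => nH; move: H; rewrite /= esum1 ?ltxx// => u _.
apply/eqP; rewrite eq_le mule_ge0 ?lee_fin ?mpow_ge0// andbT leNgt.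
by apply/negP => h; apply: nH; exists u.
Qed.

(** Only positivity is needed, so one path is followed in place of the Chapman-Kolmogorov sum. *)
Lemma mpow_add_gt0 i j s t u :
  (0 < mpow P i s t)%E -> (0 < mpow P j t u)%E ->
  (0 < mpow P (i + j) s u)%E.
Proof.
move=> Hi Hj; elim: i s Hi => [|i IH] s Hi.
  by move: Hi; rewrite /= lte_fin; case: eqVneq => [->//|_]; rewrite ltxx.
have [w Hw] := mpow_path Hi.
have Pw : (0 < (P s w)%:E)%E.
  rewrite lt0e lee_fin P_ge0 andbT; apply/eqP => Pw0; move: Hw.
  by rewrite Pw0 mul0e ltxx.
have pw : (0 < mpow P i w t)%E by rewrite -(pmule_rgt0 _ Pw).
have h : (0 < (P s w)%:E * mpow P (i + j) w u)%E by rewrite pmule_rgt0// IH.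
apply: (lt_le_trans h); rewrite addSn /=.
apply: esum_ge; exists [set w]; first by split.
by rewrite fsbig_set1.
Qed.

(** Aperiodicity is given at some state t; its consecutive return times are carried to s by a fixed
    path from s to t and another one back. *)
Lemma aperiodic_consecutive s :
  irreducible_mx P -> aperiodic P ->
  exists r, (0 < mpow P r s s)%E /\ (0 < mpow P r.+1 s s)%E.
Proof.
move=> irr [t gcdt].
set A := [set n | _] in gcdt.
have Aadd i j : A i -> A j -> A (i + j)%N.
  by move=> [i1 Hi] [j1 Hj]; split; [lia|exact: mpow_add_gt0 Hi Hj].
have Aex : exists n, A n.
  apply: contrapT => nA; suff : (2 %| 1)%N by [].
  by apply: gcdt.2 => n An; exfalso; apply: nA; exists n.
have [n [[_ An] [_ An1]]] := consecutive_of_gcd1 Aex Aadd gcdt.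
have [i Hi] := irr s t; have [j Hj] := irr t s.
exists (i + n + j)%N; split; first by apply: mpow_add_gt0 Hj => //; exact: mpow_add_gt0 Hi An.
rewrite -addSn -addnS; apply: mpow_add_gt0 Hj => //; exact: mpow_add_gt0 Hi An1.
Qed.

Hypothesis P_rec : recurrent P.
Variable s : S.
Hypothesis pi_s : 0 < pi s.

(** * Recurrence of the state s in both directions of time *)

Section Recurrence.
Implicit Types (x y : int -> S) (a b i j c : int) (t : S) (E G : set X).

Definition never_after i : set X := [set x | forall j, i < j -> x j <> s].
Definition never_before i : set X := [set x | forall j, j < i -> x j <> s].

Lemma never_after_measurable i : measurable (never_after i).
Proof.
rewrite (_ : never_after i = ~` \bigcup_(k : nat) coord_set (i + 1 + k%:Z) s).
  by apply: measurableC; apply: bigcupT_measurable => k; exact: coord_measurable.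
apply/seteqP; split => [x H [k _ /= xk]|x H j ij xj]; first by apply: (H _ _ xk); lia.
apply: H; exists (absz (j - i - 1)%R) => //=; rewrite /coord_set /= -xj; congr x; lia.
Qed.

Lemma never_before_measurable i : measurable (never_before i).
Proof.
rewrite (_ : never_before i = ~` \bigcup_(k : nat) coord_set (i - 1 - k%:Z) s).
  by apply: measurableC; apply: bigcupT_measurable => k; exact: coord_measurable.
apply/seteqP; split => [x H [k _ /= xk]|x H j ij xj]; first by apply: (H _ _ xk); lia.
apply: H; exists (absz (i - j - 1)%R) => //=; rewrite /coord_set /= -xj; congr x; lia.
Qed.

(* Disjoint subsets of [s]_0 whose measures are [mpow n s s] times a constant:
   divergence of the Green function forces the constant to vanish. *)
Let recurrence_null (D : set X) (F : nat -> set X) : measurable D ->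
  D `<=` coord_set 0 s ->
  (forall k, measurable (F k)) -> (forall k, F k `<=` coord_set 0 s) ->
  trivIset setT F -> (forall k, (pi s)%:E * m (F k) = (pi s)%:E * (mpow P k s s * m D))%E ->
  m D = 0%E.
Proof.
move=> mD Ds mF Fs tF mFk.
have Dfin := m_sub_coord mD Ds.
have : (m (\bigcup_k F k) <= (pi s)%:E)%E.
  rewrite -(m_coord 0); apply: le_measure; rewrite ?inE//.
  - exact: bigcupT_measurable.
  - exact: coord_measurable.
  - by move=> x [k _ /Fs].
rewrite measure_bigcup//.
have Fk k : m (F k) = ((fine (m D))%:E * mpow P k s s)%E.
  have /(congr1 (mule ((pi s)^-1)%:E)) := mFk k.
  rewrite !muleA -EFinM mulVf ?gt_eqF// !mul1e => ->.
  by rewrite fineK// muleC.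
under eq_eseriesr do rewrite Fk.
rewrite nneseriesZl//; last by move=> k _; exact: mpow_ge0.
have -> : (\sum_(i <oo | i \in [set: nat]) mpow P i s s = +oo)%E.
  by rewrite -(P_rec s); apply: eq_eseriesl => k; rewrite in_setT.
have [D0|D0] := eqVneq (m D) 0%E; first by [].
rewrite gt0_muley ?lte_fin ?fine_gt0//.
by rewrite lt0e D0 measure_ge0/= ltey_eq Dfin.
Qed.

Lemma last_visit_null : m (coord_set 0 s `&` never_after 0) = 0%E.
Proof.
pose D := coord_set 0 s `&` never_after 0.
have mD : measurable D.
  by apply: measurableI; [exact: coord_measurable|exact: never_after_measurable].
(* [F k] is the event that a path with x_0 = s visits s for the last time at k. *)
pose F (k : nat) := coord_set 0 s `&` shiftz k%:Z @^-1` D.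
have ms : measurable (coord_set 0 s : set X) by exact: coord_measurable.
apply: (@recurrence_null D F) => //; first by move=> x [].
- by move=> k; rewrite /F; apply: measurableI => //; exact: shiftz_measurable.
- by move=> k x [].
- move=> k l _ _ [x [[_ [/= xk Hk]] [_ [/= xl Hl]]]].
  rewrite /shiftz /coord_set /= add0r in xk xl.
  have [kl|kl|//] := ltngtP k l; exfalso.
    apply: (Hk (l%:Z - k%:Z)); first by lia.
    by rewrite /shiftz -xl; congr x; lia.
  apply: (Hl (k%:Z - l%:Z)); first by lia.
  by rewrite /shiftz -xk; congr x; lia.
- move=> k; rewrite (@markov_property k 0 k%:Z s s) ?add0r//.
  + by rewrite m_coord m_shift// muleA.
  + exact: shiftz_measurable.
  + by move=> x y xy; rewrite /coord_set /= => <-; rewrite xy.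
  + move=> x y xy [x0 H]; split; first by rewrite -x0 /shiftz /= xy//; lia.
    by move=> j j0; rewrite /shiftz -xy; [exact: H|lia].
  + by move=> x []; rewrite /shiftz /coord_set /= add0r.
Qed.

Lemma first_visit_null : m (coord_set 0 s `&` never_before 0) = 0%E.
Proof.
pose D := coord_set 0 s `&` never_before 0.
have mD : measurable D.
  by apply: measurableI; [exact: coord_measurable|exact: never_before_measurable].
(* Now the first visit is at -k and the path is again at s at time 0; working in the two-sided shift
   replaces the passage to the dual chain. *)
pose F (k : nat) := shiftz (- k%:Z) @^-1` D `&` coord_set 0 s.
have ms : measurable (coord_set 0 s : set X) by exact: coord_measurable.
apply: (@recurrence_null D F) => //; first by move=> x [].
- by move=> k; rewrite /F; apply: measurableI => //; exact: shiftz_measurable.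
- by move=> k x [].
- move=> k l _ _ [x [[[/= xk Hk] _] [[/= xl Hl] _]]].
  rewrite /shiftz /coord_set /= add0r in xk xl.
  have [kl|kl|//] := ltngtP k l; exfalso.
    apply: (Hk (k%:Z - l%:Z)); first by lia.
    by rewrite /shiftz -xl; congr x; lia.
  apply: (Hl (l%:Z - k%:Z)); first by lia.
  by rewrite /shiftz -xk; congr x; lia.
- move=> k; rewrite (@markov_property k (- k%:Z) 0 s s) ?addNr//.
  + by rewrite m_coord m_shift// [RHS]muleC; congr (_ * _)%E; rewrite muleC.
  + exact: shiftz_measurable.
  + move=> x y xy [x0 H]; split; first by rewrite -x0 /shiftz /= xy//; lia.
    by move=> j j0; rewrite /shiftz -xy; [exact: H|lia].
  + by move=> x y xy; rewrite /coord_set /= => <-; rewrite xy.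
  + by move=> x []; rewrite /shiftz /coord_set /= add0r.
Qed.

Lemma null_sub E G : measurable E -> measurable G -> E `<=` G -> m G = 0%E -> m E = 0%E.
Proof.
move=> mE mG EG G0; apply/eqP; rewrite eq_le measure_ge0 andbT -G0.
by apply: le_measure; rewrite ?inE.
Qed.

Lemma null_bigcup (F : nat -> set X) : (forall k, measurable (F k)) ->
  (forall k, m (F k) = 0%E) -> m (\bigcup_k F k) = 0%E.
Proof.
move=> mF F0; apply/eqP; rewrite eq_le measure_ge0 andbT.
have mU : measurable (\bigcup_k F k) by exact: bigcupT_measurable.
apply: le_trans (measure_sigma_subadditive m mF mU (@subset_refl _ _)) _.
by rewrite eseries0.
Qed.

(** Without visits after N there is a last one, at some 0 <= k <= N; moving it to the origin lands
    in the null set of [last_visit_null]. *)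
Lemma visits_after (N : nat) : m (coord_set 0 s `&` never_after N%:Z) = 0%E.
Proof.
have mD : measurable (coord_set 0 s `&` never_after 0).
  by apply: measurableI; [exact: coord_measurable|exact: never_after_measurable].
apply: (@null_sub _ (\bigcup_(k : nat) (shiftz k%:Z @^-1` (coord_set 0 s `&` never_after 0)))).
- by apply: measurableI; [exact: coord_measurable|exact: never_after_measurable].
- by apply: bigcupT_measurable => k; exact: shiftz_measurable.
- move=> x [x0 H].
  have ex : exists k : nat, x k%:Z == s by exists 0%N; apply/eqP.
  have ub (k : nat) : x k%:Z == s -> (k <= N)%N.
    by move=> /eqP xk; rewrite leqNgt; apply/negP => Nk; apply: (H k%:Z).
  case: (ex_maxnP ex ub) => k /eqP xk kmax; exists k => //.
  split; first by rewrite /shiftz /coord_set /= add0r.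
  move=> j j0; rewrite /shiftz => xj.
  have := kmax (absz (j + k%:Z)%R); rewrite gez0_abs; last by lia.
  by rewrite xj eqxx => /(_ isT); lia.
- apply: null_bigcup => k; first exact: shiftz_measurable.
  by rewrite m_shift ?last_visit_null.
Qed.

Lemma visits_before (N : nat) : m (coord_set 0 s `&` never_before (- N%:Z)) = 0%E.
Proof.
have mD : measurable (coord_set 0 s `&` never_before 0).
  by apply: measurableI; [exact: coord_measurable|exact: never_before_measurable].
apply: (@null_sub _ (\bigcup_(k : nat) (shiftz (- k%:Z) @^-1` (coord_set 0 s `&` never_before 0)))).
- by apply: measurableI; [exact: coord_measurable|exact: never_before_measurable].
- by apply: bigcupT_measurable => k; exact: shiftz_measurable.
- move=> x [x0 H].
  have ex : exists k : nat, x (- k%:Z) == s by exists 0%N; rewrite oppr0; apply/eqP.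
  have ub (k : nat) : x (- k%:Z) == s -> (k <= N)%N.
    by move=> /eqP xk; rewrite leqNgt; apply/negP => Nk; apply: (H (- k%:Z)) => //; lia.
  case: (ex_maxnP ex ub) => k /eqP xk kmax; exists k => //.
  split; first by rewrite /shiftz /coord_set /= add0r.
  move=> j j0; rewrite /shiftz => xj.
  have := kmax (absz (k%:Z - j)%R); rewrite gez0_abs; last by lia.
  by rewrite opprB xj eqxx => /(_ isT); lia.
- apply: null_bigcup => k; first exact: shiftz_measurable.
  by rewrite m_shift ?first_visit_null.
Qed.

(** Given x_0 = t, the path is at s at a suitable time n with positive probability, independently of
    the past. A positive mass of paths avoiding s up to time 0 would thus give, seen from time n, a
    positive mass of paths through s with no visit before -n. *)
Lemma past_visit : irreducible_mx P -> m (never_before 1) = 0%E.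
Proof.
move=> P_irr; rewrite (measure_split 0); last exact: never_before_measurable.
apply: esum1 => t _; have [n np] := P_irr t s.
have mE : measurable (never_before 1 `&` coord_set 0 t : set X).
  by apply: measurableI; [exact: never_before_measurable|exact: coord_measurable].
have ms : measurable (coord_set n%:Z s : set X) by exact: coord_measurable.
have H : ((pi s)%:E * m (never_before 1 `&` coord_set 0 t `&` coord_set n%:Z s) =
    m (never_before 1 `&` coord_set 0 t) * mpow P n t s * m (coord_set n%:Z s))%E.
  apply: (@markov_property n 0 n%:Z t s) => //; rewrite ?add0r//.
  + move=> x y xy [H1 xt]; split => [j j1|]; last by rewrite /coord_set /= -xy.
    by rewrite -xy; [exact: H1|lia].
  + by move=> x y xy; rewrite /coord_set /= -xy.
move: H; rewrite m_coord (@null_sub _ (shiftz n%:Z @^-1` (coord_set 0 s `&` never_before (- n%:Z)))).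
- rewrite mule0 => /esym/eqP.
  by rewrite !mule_eq0 eqe (gt_eqF pi_s) (gt_eqF np) !orbF => /eqP.
- exact: measurableI.
- apply: shiftz_measurable; apply: measurableI; [exact: coord_measurable|exact: never_before_measurable].
- move=> x [[H xt] xs]; split; first by rewrite /shiftz /coord_set /= add0r.
  by move=> j jn; apply: H; lia.
- rewrite m_shift ?visits_before//.
  by apply: measurableI; [exact: coord_measurable|exact: never_before_measurable].
Qed.

End Recurrence.

(** * Correlations of s-blocks and bounds on the number of visits *)

Section Blocks.
Implicit Types (x y : int -> S) (E G : set X).

(** This is u_k([s]_0), the v_k of the overview; [green n] is a_n([s]_0). *)
Definition renewal (k : nat) : R := fine (mpow P k s s) / pi s.
Definition green (n : nat) : R := \sum_(0 <= k < n) renewal k.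

Lemma renewal_ge0 k : 0 <= renewal k.
Proof. by rewrite divr_ge0// fine_ge0// mpow_ge0. Qed.

Lemma green_ge0 n : 0 <= green n.
Proof. by apply: sumr_ge0 => k _; exact: renewal_ge0. Qed.

Lemma le_green n n' : (n <= n')%N -> green n <= green n'.
Proof.
move=> nn'; rewrite /green (@big_cat_nat _ _ _ n 0 n')//= lerDl.
by apply: sumr_ge0 => k _; exact: renewal_ge0.
Qed.

Lemma green_cvg : green n @[n --> \oo] --> +oo.
Proof.
have gE n : (\sum_(0 <= k < n) mpow P k s s)%E = (pi s * green n)%:E.
  rewrite /green mulr_sumr -sumEFin; apply: eq_bigr => k _.
  by rewrite /renewal mulrC divfK ?gt_eqF// fineK ?mpow_fin.
apply: nondecreasing_dvgn_lt; first by move=> n k nk; exact: le_green.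
move=> cg.
have := P_rec s.
rewrite (_ : (fun n => \sum_(0 <= k < n) mpow P k s s)%E = EFin \o (fun n => pi s * green n)); last first.
  by apply/funext => n; rewrite gE.
move=> H.
have : (EFin \o (fun n => pi s * green n)) n @[n --> \oo] --> (pi s * limn green)%:E.
  by apply: cvg_EFin; [exact: nearW|apply: cvgMr].
by move=> /cvg_lim; rewrite H => /(_ (@ereal_hausdorff R)).
Qed.

(** The visit at time 0 keeps blocks inside [s]_0, a set of finite mass. *)
Definition block (a b : nat) (C : set X) :=
  [/\ measurable C, forall x y, (forall j, - a%:Z <= j <= b%:Z -> x j = y j) -> C x -> C y,
      C `<=` coord_set 0 s, C `<=` coord_set (- a%:Z) s & C `<=` coord_set b%:Z s].

Lemma block_fin a b C : block a b C -> m C \is a fin_num.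
Proof. by move=> [mC _ C0 _ _]; exact: m_sub_coord C0. Qed.

Lemma coord_block : block 0 0 (coord_set 0 s).
Proof.
split => //; first exact: coord_measurable.
by move=> x y xy; rewrite /coord_set /= => <-; rewrite xy.
Qed.

Lemma block_mix a b a' b' C C' (k : nat) : block a b C -> block a' b' C' ->
  (b + a' <= k)%N ->
  mf (C `&` shiftz k%:Z @^-1` C') = mf C * mf C' * renewal (k - (b + a')).
Proof.
move=> bC bC' k0; have fC := block_fin bC; have fC' := block_fin bC'.
case: bC => mC dC C0 Ca Cb; case: bC' => mC' dC' C0' Ca' Cb'.
have mS : measurable (shiftz k%:Z @^-1` C') by exact: shiftz_measurable.
have : ((pi s)%:E * m (C `&` shiftz k%:Z @^-1` C') =
    m C * mpow P (k - (b + a')) s s * m (shiftz k%:Z @^-1` C'))%E.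
  apply: (@markov_property _ b%:Z (k%:Z - a'%:Z)) => //.
  - lia.
  - by move=> x y xy; apply: dC => j hj; apply: xy; lia.
  - by move=> x y xy; apply: dC' => j hj; apply: xy; lia.
  - by move=> x /Ca' /=; rewrite /coord_set /shiftz /= addrC.
rewrite m_shift// => /(congr1 fine); rewrite !fineM ?fin_numM ?mpow_fin//=; last first.
  by apply: (fin_measure_sub _ mC) => //; exact: measurableI.
move=> H; apply: (@mulfI _ (pi s)); first by rewrite gt_eqF.
by rewrite H /renewal; field; rewrite gt_eqF.
Qed.

Lemma block_inter a b a' b' C C' (k : nat) : block a b C -> block a' b' C' ->
  (a' <= a + k)%N -> (b <= k + b')%N ->
  block a (k + b') (C `&` shiftz k%:Z @^-1` C').
Proof.
move=> [mC dC C0 Ca Cb] [mC' dC' C0' Ca' Cb'] ha hb; split.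
- by apply: measurableI => //; exact: shiftz_measurable.
- move=> x y xy [Cx Cx']; split; first by apply: dC Cx => j hj; apply: xy; lia.
  by apply: dC' Cx' => j hj; apply: xy; lia.
- by move=> x [/C0].
- by move=> x [/Ca].
- by move=> x [_ /Cb']; rewrite /coord_set /shiftz /= PoszD addrC.
Qed.

(** A majorant of m(C & T^-k C) / m(C) for a block C, with l = a + b and c = m(C): the trivial bound
    while the two windows overlap, the exact value afterwards. *)
Definition delayed (l : nat) (c : R) (k : nat) : R := if (k < l)%N then 1 else c * renewal (k - l).

Lemma delayed_ge0 l (c : R) k : 0 <= c -> 0 <= delayed l c k.
Proof. by move=> c0; rewrite /delayed; case: ifP => // _; rewrite mulr_ge0// renewal_ge0. Qed.

Lemma sum_delayed l (c : R) n : 0 <= c ->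
  \sum_(0 <= k < n) delayed l c k <= l%:R + c * green n.
Proof.
move=> c0; have [nl|ln] := leqP n l.
  apply: (@le_trans _ _ (\sum_(0 <= k < n) 1)).
    by apply: ler_sum_nat => k kn; rewrite /delayed ifT//; lia.
  rewrite sumr_const_nat subn0 -[leLHS]addr0 lerD ?ler_nat// mulr_ge0//.
  exact: green_ge0.
rewrite (@big_cat_nat _ _ _ l)//=; last exact: ltnW.
apply: lerD.
  rewrite (@eq_big_nat _ _ _ _ _ _ (fun=> 1)) ?sumr_const_nat ?subn0//.
  by move=> k kl; rewrite /delayed ifT//; lia.
rewrite -{1}[l]add0n big_addn.
rewrite (@eq_big_nat _ _ _ _ _ _ (fun k => c * renewal k)); last first.
  by move=> k _; rewrite /delayed ifF ?addnK//; lia.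
by rewrite -mulr_sumr ler_wpM2l//; apply: le_green; lia.
Qed.

(** Each of the two gaps is either at least a + b, and the Markov property splits off a factor, or
    shorter, and one of the events is dropped. *)
Lemma block_triple a b C (i g : nat) : block a b C ->
  mf (C `&` shiftz i%:Z @^-1` C `&` shiftz (i + g)%N%:Z @^-1` C) <=
  mf C * delayed (a + b) (mf C) i * delayed (a + b) (mf C) g.
Proof.
move=> bC; have fC := block_fin bC; have mfC0 := fine_measure_ge0 m C.
have mC : measurable C by case: bC.
have bI k : block a (k + b) (C `&` shiftz k%:Z @^-1` C) by apply: (@block_inter a b a b) => //; lia.
have IE : C `&` shiftz i%:Z @^-1` C `&` shiftz (i + g)%N%:Z @^-1` C =
    C `&` shiftz i%:Z @^-1` (C `&` shiftz g%:Z @^-1` C).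
  by rewrite -setIA preimage_setI shiftz_comp.
have mI k : measurable (C `&` shiftz k%:Z @^-1` C) by case: (bI k).
have leC k : mf (C `&` shiftz k%:Z @^-1` C) <= mf C by apply: fine_measure_le.
rewrite /delayed; case: (ltnP g (a + b)) => hg.
  rewrite mulr1 IE; case: (ltnP i (a + b)) => hi.
    rewrite mulr1; apply: fine_measure_le => //; apply: measurableI => //.
    exact: shiftz_measurable.
  rewrite (@block_mix a b a (g + b) _ _ i)//; last lia.
  by rewrite (addnC b) [leRHS]mulrA ler_wpM2r ?renewal_ge0// ler_wpM2l.
rewrite (@block_mix a (i + b) a b _ _ (i + g))//; last lia.
rewrite (_ : i + g - (i + b + a) = g - (a + b))%N; last lia.
rewrite [leRHS]mulrA ler_wpM2r ?renewal_ge0// ler_wpM2r//.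
case: (ltnP i (a + b)) => hi; first by rewrite mulr1.
by rewrite (@block_mix a b a b)// ?(addnC b)//= ?mulrA// addnC.
Qed.

(** The sequence E is abstract so that the bound serves both for the sets T^-k C and for their
    mirror images T^k C. *)
Lemma second_moment a b C D (E : nat -> set X) n (eta : R) : block a b C ->
  measurable D -> D `<=` C -> 0 < eta -> mf D <= eta ^+ 2 * mf C ->
  (forall k, measurable (E k)) ->
  (forall i g : nat, mf (C `&` E i `&` E (i + g)%N) <=
     mf C * delayed (a + b) (mf C) i * delayed (a + b) (mf C) g) ->
  \sum_(0 <= k < n) mf (D `&` E k) <=
    3 / 2 * eta * mf C * ((a + b).+1%:R + mf C * green n).
Proof.
move=> bC mD DC eta0 De mE triple.
have fC := block_fin bC; have c0 := fine_measure_ge0 m C.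
have mC : measurable C by case: bC.
(* The successor keeps L positive, as it will be a divisor. *)
set L := (a + b).+1%:R + mf C * green n.
have L0 : 0 < L by rewrite ltr_wpDr// mulr_ge0// green_ge0.
pose r k := delayed (a + b) (mf C) k.
have r0 k : 0 <= r k by exact: delayed_ge0.
have rL : \sum_(0 <= k < n) r k <= L.
  apply: le_trans (sum_delayed _ _ c0) _.
  by rewrite /L lerD2r ler_nat.
have sr0 : 0 <= \sum_(0 <= k < n) r k by exact: sumr_ge0.
(* Pairs in increasing order only; adding both orders counts the diagonal twice, which an upper
   bound allows. *)
pose h i j := if (i <= j)%N then r i * r (j - i)%N else 0.
have half : \sum_(0 <= i < n) \sum_(0 <= j < n) h i j <= L ^+ 2.
  apply: (@le_trans _ _ (\sum_(0 <= i < n) r i * \sum_(0 <= k < n) r k)).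
    apply: ler_sum_nat => i /andP[_ hin].
    rewrite (@big_cat_nat _ _ _ i)//=; last exact: ltnW.
    rewrite big_nat_cond big1 ?add0r; last first.
      by move=> j; rewrite andbT => /andP[_ ji]; rewrite /h leqNgt ji.
    rewrite -{1}[i]add0n big_addn.
    rewrite (@eq_big_nat _ _ _ _ _ _ (fun k => r i * r k)); last first.
      by move=> k _; rewrite /h leq_addl addnK.
    rewrite -mulr_sumr ler_wpM2l//.
    by rewrite [leRHS](@big_cat_nat _ _ _ (n - i)) ?leq_subr//= lerDl sumr_ge0.
  by rewrite -mulr_suml expr2 ler_pM.
have double : \sum_(0 <= i < n) \sum_(0 <= j < n) mf (C `&` E i `&` E j) <=
    mf C * (2 * L ^+ 2).
  apply: (@le_trans _ _ (\sum_(0 <= i < n) \sum_(0 <= j < n) mf C * (h i j + h j i))).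
    apply: ler_sum => i _; apply: ler_sum => j _.
    have h0 k l : 0 <= h k l by rewrite /h; case: ifP => // _; exact: mulr_ge0.
    have [ij|ji] := leqP i j.
      apply: (@le_trans _ _ (mf C * h i j)); last by rewrite ler_wpM2l// lerDl.
      by have := triple i (j - i)%N; rewrite subnKC// /h ij mulrA.
    apply: (@le_trans _ _ (mf C * h j i)); last by rewrite ler_wpM2l// lerDr.
    have := triple j (i - j)%N; rewrite subnKC ?(ltnW ji)// /h (ltnW ji) mulrA.
    by rewrite setIAC.
  under eq_bigr do rewrite -mulr_sumr big_split /=.
  rewrite -mulr_sumr big_split /= ler_wpM2l//.
  by rewrite [X in _ + X]exchange_big /=; lra.
(* With l = L / eta the two terms are at most eta m(C) L / 2 and eta m(C) L, whence the constant
   3/2. *)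
apply: le_trans (@sum_measure_second_moment _ _ _ m n E C D (L / eta) _ mD mC DC fC mE) _.
  exact: divr_gt0.
apply: (@le_trans _ _ (L / eta / 2 * (eta ^+ 2 * mf C) + (2 * (L / eta))^-1 * (mf C * (2 * L ^+ 2)))).
  apply: lerD; apply: ler_wpM2l => //; first by rewrite !divr_ge0// ltW.
  by rewrite invr_ge0 mulr_ge0// divr_ge0 ?ltW.
by rewrite le_eqVlt; apply/orP; left; apply/eqP; field; rewrite !gt_eqF.
Qed.

Lemma sum_hits a b C D n (eta : R) : block a b C ->
  measurable D -> D `<=` C -> 0 < eta -> mf D <= eta ^+ 2 * mf C ->
  \sum_(0 <= k < n) mf (D `&` shiftz k%:Z @^-1` C) <=
    3 / 2 * eta * mf C * ((a + b).+1%:R + mf C * green n).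
Proof.
move=> bC mD DC eta0 De; apply: second_moment => //.
  by move=> k; apply: shiftz_measurable; case: bC.
by move=> i g; exact: block_triple.
Qed.

(** By invariance m(C & T^-k D) = m(D & T^k C), so D is again observed at time 0 and visits are
    counted in the past; reversing time swaps the two gaps in the triple bound. *)
Lemma sum_hits_back a b C D n (eta : R) : block a b C ->
  measurable D -> D `<=` C -> 0 < eta -> mf D <= eta ^+ 2 * mf C ->
  \sum_(0 <= k < n) mf (C `&` shiftz k%:Z @^-1` D) <=
    3 / 2 * eta * mf C * ((a + b).+1%:R + mf C * green n).
Proof.
move=> bC mD DC eta0 De; have mC : measurable C by case: bC.
have mS c A : measurable A -> measurable (shiftz c @^-1` A) by exact: shiftz_measurable.
rewrite (@eq_big_nat _ _ _ _ _ _ (fun k => mf (D `&` shiftz (- k%:Z) @^-1` C))); last first.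
  move=> k _; rewrite -[in RHS](m_shift k%:Z); last by apply: measurableI => //; exact: mS.
  by rewrite preimage_setI shiftz_comp subrr shiftz0 setIC.
apply: second_moment => //; first by move=> k; exact: mS.
move=> i g; rewrite mulrAC; apply: le_trans (block_triple g i bC).
rewrite -[in leLHS](m_shift (i + g)%N%:Z); last first.
  by apply: measurableI; [apply: measurableI|]; rewrite //; exact: mS.
rewrite !preimage_setI !shiftz_comp (_ : (i + g)%N%:Z - (i + g)%N%:Z = 0); last lia.
rewrite shiftz0 (_ : (i + g)%N%:Z - i%:Z = g%:Z); last lia.
by rewrite setIC setIA setIAC (addnC g) -setIA setICA setIA.
Qed.

End Blocks.

(** * Approximation by disjoint blocks and a density property *)

Section BlockApproximation.
Implicit Types (x y : int -> S) (E G : set X).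

Lemma window_set_measurable N (U : set X) : window_set N U -> measurable U.
Proof.
move=> /(window_determined_bigcup countS)[F [-> FP]].
apply: bigcupT_measurable => i; have [->|[y ->]] := FP i; first exact: measurable0.
by apply: window_measurable; lia.
Qed.

(** On each side, among the visits to s at distance at least N from the origin, -a and b are the
    closest ones. They are determined by the path, so distinct pairs give disjoint pieces; a set U
    that depends only on [-N, N] is thereby cut into blocks. *)
Definition piece (N : nat) (U : set X) (a b : nat) : set X :=
  [set x | [/\ (N <= a)%N /\ (N <= b)%N, U x /\ x 0 = s,
    x (- a%:Z) = s /\ x b%:Z = s,
    forall k : nat, (N <= k < a)%N -> x (- k%:Z) <> s &
    forall k : nat, (N <= k < b)%N -> x k%:Z <> s]].

Lemma piece_block N U a b : window_set N U -> block a b (piece N U a b).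
Proof.
move=> wU.
have dep x y : (forall j, - a%:Z <= j <= b%:Z -> x j = y j) ->
    piece N U a b x -> piece N U a b y.
  move=> xy [[Na Nb] [Ux x0] [xa xb] xl xr]; split => //.
  - by split; [apply: wU Ux => j hj; apply: xy; lia|rewrite -xy//; lia].
  - by rewrite -!xy//; lia.
  - by move=> k hk; rewrite -xy; [exact: xl|lia].
  - by move=> k hk; rewrite -xy; [exact: xr|lia].
split => //.
- apply: (@window_set_measurable (maxn a b)) => x y xy; apply: dep => j hj.
  by apply: xy; lia.
- by move=> x [_ []].
- by move=> x [_ _ []].
- by move=> x [_ _ []].
Qed.

Lemma piece_inj N U a b a' b' x :
  piece N U a b x -> piece N U a' b' x -> a = a' /\ b = b'.
Proof.
move=> [[Na Nb] _ [xa xb] xl xr] [[Na' Nb'] _ [xa' xb'] xl' xr']; split.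
  have [h|h|//] := ltngtP a a'; exfalso; [apply: xl' xa|apply: xl xa']; lia.
have [h|h|//] := ltngtP b b'; exfalso; [apply: xr' xb|apply: xr xb']; lia.
Qed.

Lemma piece_cover N (U : set X) x : U x -> x 0 = s ->
  ~ never_after N%:Z x -> ~ never_before (- N%:Z) x ->
  exists a b, piece N U a b x.
Proof.
move=> Ux x0 /existsNP[j /not_implyP[Nj /contrapT xj]] /existsNP[i /not_implyP[iN /contrapT xi]].
have exb : exists b : nat, (N <= b)%N && (x b%:Z == s).
  exists (absz j); rewrite gez0_abs; last lia.
  by rewrite xj eqxx andbT; lia.
have exa : exists a : nat, (N <= a)%N && (x (- a%:Z) == s).
  exists (absz (- i)%R); rewrite gez0_abs; last lia.
  by rewrite opprK xi eqxx andbT; lia.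
case: (ex_minnP exa) => a /andP[Na /eqP xa] amin.
case: (ex_minnP exb) => b /andP[Nb /eqP xb] bmin.
exists a, b; split => // k /andP[Nk kb] xk.
  by have := amin k; rewrite Nk xk eqxx => /(_ isT); lia.
by have := bmin k; rewrite Nk xk eqxx => /(_ isT); lia.
Qed.

(** Three errors occur: U in place of A, the tail of the enumeration of pieces, and the paths
    without a visit beyond N or before -N. The first two get e / 2 each, the last is null by
    recurrence. *)
Lemma block_approx A (e : R) : measurable A -> A `<=` coord_set 0 s -> 0 < e ->
  exists n (C : nat -> set X),
    [/\ forall i, exists a b, block a b (C i), trivIset setT C &
        mf (symdiff A (\bigcup_(i < n) C i)) <= e].
Proof.
move=> mA As e0; have e20 : 0 < e / 2 by lra.
have ms : measurable (coord_set 0 s : set X) by exact: coord_measurable.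
have fs : m (coord_set 0 s) \is a fin_num by apply: (m_sub_coord ms (@subset_refl _ _)).
have [N [U [mU wU Ue]]] := window_approx ms fs mA e20.
pose C i := if @pickle_inv (nat * nat)%type i is Some (a, b) then piece N U a b else set0.
have bC i : exists a b, block a b (C i).
  rewrite /C; case: pickle_inv => [[a b]|]; first by exists a, b; exact: piece_block.
  by exists 0%N, 0%N; split.
have mC i : measurable (C i) by have [a [b []]] := bC i.
have Cs i : C i `<=` coord_set 0 s by have [a [b []]] := bC i.
have CU i : C i `<=` U.
  by rewrite /C; case: pickle_inv => [[a b]|] // x [_ []].
have tC : trivIset setT C.
  move=> k l _ _ [x []]; rewrite /C.
  case Ek: (pickle_inv k) => [[a b]|//]; case El: (pickle_inv l) => [[a' b']|//].
  move=> h1 h2; have [aE bE] := piece_inj h1 h2.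
  have := @pickle_invK (nat * nat)%type k; have := @pickle_invK (nat * nat)%type l.
  by rewrite /oapp Ek El aE bE => <- <-.
have [n Hn] := tail_small (m := m) e20 mC ms (@bigcup_sub _ _ _ _ _ (fun i _ => Cs i)) fs.
exists n, C; split => //.
have mUC : measurable (\bigcup_i C i) by exact: bigcupT_measurable.
have mCn : measurable (\bigcup_(i < n) C i) by exact: bigcup_measurable.
pose Z : set X := coord_set 0 s `&` never_after N%:Z `|` coord_set 0 s `&` never_before (- N%:Z).
have mna : measurable (coord_set 0 s `&` never_after N%:Z).
  by apply: measurableI => //; exact: never_after_measurable.
have mnb : measurable (coord_set 0 s `&` never_before (- N%:Z)).
  by apply: measurableI => //; exact: never_before_measurable.
have mZ : measurable Z by exact: measurableU.
have Z0 : m Z = 0%E by rewrite (measureU0 mna mnb (visits_before N)) visits_after.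
pose B1 := coord_set 0 s `&` symdiff A U.
pose B2 := \bigcup_i C i `\` \bigcup_(i < n) C i.
have mB1 : measurable B1 by apply: measurableI => //; exact: symdiff_measurable.
have mB2 : measurable B2 by exact: measurableD.
have fB1 : m B1 \is a fin_num by apply: fin_measure_sub fs => // x [].
have fB2 : m B2 \is a fin_num by apply: fin_measure_sub fs => // x [[i _ /Cs]].
apply: (@le_trans _ _ (mf (B1 `|` B2 `|` Z))).
  apply: fine_measure_le.
  - exact: symdiff_measurable.
  - by do 2 apply: measurableU => //.
  - move=> x [[Ax nC]|[[i /= hi Cx] nA]]; last first.
      by left; left; split; [exact: Cs Cx|right; split => //; exact: CU Cx].
    have x0 := As _ Ax.
    have [Ux|nU] := pselect (U x); last by left; left; split => //; left.
    have [na|na] := pselect (never_after N%:Z x); first by right; left.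
    have [nb|nb] := pselect (never_before (- N%:Z) x); first by right; right.
    left; right; split => //.
    have [a [b pab]] := piece_cover Ux x0 na nb.
    by exists (pickle (a, b)) => //; rewrite /C pickleK_inv.
  - apply: fin_measure_sub fs => //; first by do 2 apply: measurableU => //.
    by move=> x [[[]//|[[i _ /Cs]//]]|[[]|[]]].
rewrite measureU0//; last exact: measurableU.
by apply: le_trans (fine_measureU mB1 mB2 fB1 fB2) _; rewrite /B1 /B2; lra.
Qed.

Lemma fine_measure_bigcup n (C : nat -> set X) (B : set X) : (forall i, measurable (C i)) ->
  trivIset setT C -> measurable B -> (forall i, m (C i) \is a fin_num) ->
  mf (\bigcup_(i < n) C i `&` B) = \sum_(0 <= i < n) mf (C i `&` B).
Proof.
move=> mC tC mB fC; elim: n => [|n IH].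
  by rewrite bigcup_mkord big_ord0 set0I measure0 big_geq.
have mI i : measurable (C i `&` B) by exact: measurableI.
rewrite big_nat_recr//= -IH bigcup_mkord big_ord_recr /= setIUl -bigcup_mkord.
have mU k : measurable (\bigcup_(i < k) C i `&` B).
  by apply: measurableI => //; exact: bigcup_measurable.
rewrite measureU//; last first.
  apply/seteqP; split => // x [[[i /= hi Cix] _] [Cnx _]].
  have : i = n by apply: tC => //; exists x.
  by lia.
rewrite fineD//; last by apply: fin_measure_sub (fC n).
elim: n {IH} => [|n IH]; first by rewrite bigcup_mkord big_ord0 set0I measure0.
rewrite bigcup_mkord big_ord_recr /= setIUl -bigcup_mkord ge0_fin_numE ?measure_ge0//.
apply: le_lt_trans (measureU2 _ (mU n) (mI n)) _.
rewrite ltey_eq fin_numD IH /=.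
by rewrite (fin_measure_sub (mI n) (mC n))//; exact: subIsetl.
Qed.

(** A substitute for Lebesgue density: if A filled no block of an approximating union well, it would
    fill the union badly, against the approximation. *)
Lemma block_density A (e : R) : measurable A -> A `<=` coord_set 0 s ->
  0 < mf A -> 0 < e ->
  exists a b C, [/\ block a b C, 0 < mf C & mf (C `\` A) <= e * mf C].
Proof.
move=> mA As A0 e0.
have fA : m A \is a fin_num by exact: m_sub_coord As.
(* For the union U, e m(U) <= d and m(U) >= m(A) - d would give e m(A) <= (1 + e) d, which is only
   half of e m(A). *)
pose d := mf A * e / (2 * (1 + e)).
have d0 : 0 < d by rewrite divr_gt0 ?mulr_gt0//; lra.
have [n [C [bC tC Hd]]] := block_approx mA As d0.
have mC i : measurable (C i) by have [a [b []]] := bC i.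
have fC i : m (C i) \is a fin_num by have [a [b /block_fin]] := bC i.
apply: contrapT => H.
have bad i : e * mf (C i) <= mf (C i `\` A).
  have [a [b bCi]] := bC i; rewrite leNgt; apply/negP => h.
  apply: H; exists a, b, (C i); split => //; last exact: ltW.
  rewrite -(pmulr_rgt0 _ e0); apply: le_lt_trans h; exact: fine_measure_ge0.
have mCn : measurable (\bigcup_(i < n) C i) by exact: bigcup_measurable.
have ms : measurable (coord_set 0 s : set X) by exact: coord_measurable.
have fs : m (coord_set 0 s) \is a fin_num by apply: (m_sub_coord ms (@subset_refl _ _)).
have Cs i : C i `<=` coord_set 0 s by have [a [b []]] := bC i.
have fCn : m (\bigcup_(i < n) C i) \is a fin_num.
  by apply: fin_measure_sub fs => // x [i _ /Cs].
have fS : m (symdiff A (\bigcup_(i < n) C i)) \is a fin_num.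
  apply: fin_measure_sub fs => //; first exact: symdiff_measurable.
  by move=> x [[/As]|[[i _ /Cs]]].
have h1 : mf (\bigcup_(i < n) C i `\` A) <= d.
  apply: le_trans Hd; apply: fine_measure_le => //; first exact: measurableD.
  - exact: symdiff_measurable.
  - by move=> x ?; right.
have h2 : mf A - mf (\bigcup_(i < n) C i) <= d.
  apply: le_trans Hd; apply: le_trans (fine_measure_distance _ _ _ _) => //.
  exact: ler_norm.
have h3 : e * mf (\bigcup_(i < n) C i) <= mf (\bigcup_(i < n) C i `\` A).
  rewrite -{1}[\bigcup_(i < n) C i]setIT fine_measure_bigcup// setDE.
  rewrite fine_measure_bigcup//; last exact: measurableC.
  rewrite mulr_sumr; apply: ler_sum => i _; rewrite setIT -setDE; exact: bad.
have : mf A * e <= d * (1 + e).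
  have -> : d * (1 + e) = d + e * d by ring.
  apply: le_trans (_ : e * (d + mf (\bigcup_(i < n) C i)) <= _); last by rewrite mulrDr; lra.
  by rewrite mulrC ler_pM2l//; lra.
rewrite /d (_ : _ / _ * _ = mf A * e / 2); last by field; rewrite gt_eqF//; lra.
have := mulr_gt0 A0 e0; lra.
Qed.

End BlockApproximation.

Variable K : set nat.

(** * Sequences with small averages relative to a_n([s]_0) along K *)

Section SmallAlong.
Implicit Types (x y : int -> S) (E G : set X).

Lemma eventually_green (c : R) : exists N, forall n, (N <= n)%N -> c <= green n.
Proof.
have /cvgryPge/(_ c)[N _ HN] := green_cvg.
by exists N => n Nn; exact: HN.
Qed.

Lemma renewal_le k : renewal k <= (pi s)^-1.
Proof.
rewrite /renewal ler_pdivrMr// mulVf ?gt_eqF// -lee_fin fineK ?mpow_fin//.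
exact: mpow_le1.
Qed.


(** One normalisation serves for all sets involved, and the level e is explicit so that
    approximation errors can be added before e becomes arbitrary. *)
Definition small_along (e : R) (x : nat -> R) := exists N, forall n, (N <= n)%N ->
  K n -> \sum_(0 <= k < n) `|x k| <= e * green n.

Lemma small_le e e' (x : nat -> R) : small_along e x -> e <= e' -> small_along e' x.
Proof.
move=> [N HN] ee'; exists N => n Nn Kn; apply: le_trans (HN n Nn Kn) _.
by rewrite ler_wpM2r// green_ge0.
Qed.

Lemma small_add e e' (x y z : nat -> R) : small_along e x -> small_along e' y ->
  (forall k, `|z k| <= `|x k| + `|y k|) -> small_along (e + e') z.
Proof.
move=> [N HN] [N' HN'] H; exists (maxn N N') => n; rewrite geq_max => /andP[Nn Nn'] Kn.
apply: (@le_trans _ _ (\sum_(0 <= k < n) (`|x k| + `|y k|))); first exact: ler_sum.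
by rewrite big_split /= mulrDl lerD// ?HN ?HN'.
Qed.

Lemma small_scale c e (x z : nat -> R) : 0 <= c -> small_along e x ->
  (forall k, `|z k| <= c * `|x k|) -> small_along (c * e) z.
Proof.
move=> c0 [N HN] H; exists N => n Nn Kn.
apply: (@le_trans _ _ (\sum_(0 <= k < n) (c * `|x k|))); first exact: ler_sum.
by rewrite -mulr_sumr -mulrA ler_wpM2l// HN.
Qed.

Lemma small_finite h e (x : nat -> R) : 0 < e -> (forall k, (h <= k)%N -> x k = 0) -> small_along e x.
Proof.
move=> e0 H; have [N HN] := eventually_green ((\sum_(0 <= k < h) `|x k|) / e).
exists (maxn N h) => n; rewrite geq_max => /andP[Nn hn] Kn.
rewrite (@big_cat_nat _ _ _ h)//= [X in _ + X]big_nat_cond [X in _ + X]big1 ?addr0; last first.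
  by move=> k; rewrite andbT => /andP[hk _]; rewrite H ?normr0.
by rewrite -ler_pdivrMl// mulrC; exact: HN.
Qed.

Lemma small_sum I (r : seq I) (x : I -> nat -> R) e : 0 < e ->
  (forall i e', 0 < e' -> small_along e' (x i)) ->
  small_along e (fun k => \sum_(i <- r) x i k).
Proof.
elim: r e => [|i r IH] e e0 H.
  by apply: (small_finite (h := 0) e0) => k _; rewrite big_nil.
have e20 : 0 < e / 2 by lra.
rewrite (splitr e); apply: (small_add (H i _ e20) (IH _ e20 H)) => k.
by rewrite big_cons; exact: ler_normD.
Qed.

Lemma small_bound (B : nat -> R) e (x : nat -> R) :
  (forall n, \sum_(0 <= k < n) `|x k| <= B n) ->
  (exists N, forall n, (N <= n)%N -> B n <= e * green n) -> small_along e x.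
Proof.
by move=> H [N HN]; exists N => n Nn _; apply: le_trans (H n) (HN n Nn).
Qed.

Definition smooth_renewal :=
  forall e, 0 < e -> small_along e (fun k => renewal k - renewal k.+1).

Lemma weight_renewal : weight renewal.
Proof.
split; first by exists (pi s)^-1; exact: renewal_le.
  exact: renewal_ge0.
have wE n : weight_sum renewal n = green n.+1 - renewal 0.
  by rewrite /weight_sum /green [in RHS]big_nat_recl// [in RHS]addrC addKr big_add1.
apply/cvgryPge => A; have [N HN] := eventually_green (A + renewal 0).
by exists N => // n /= Nn; rewrite wE lerBrDr; apply: HN; exact: leqW.
Qed.

(** Weight sums run over 1, ..., n and [green] over 0, ..., n - 1; the boundary terms are at most 1
    / pi s, hence negligible against a_n. *)
Lemma smooth_alongP : smooth_along K renewal <-> smooth_renewal.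
Proof.
have vM := renewal_le; have v0 := renewal_ge0.
have pi1 : 0 < (pi s)^-1 by rewrite invr_gt0.
have wE n : weight_sum renewal n = green n - renewal 0 + renewal n.
  rewrite /weight_sum /green addrAC -big_nat_recr//= [in RHS]big_nat_recl// [in RHS]addrC addKr.
  by rewrite big_add1.
pose V n := \sum_(1 <= k < n.+1) `|renewal k - renewal k.+1|.
have V0 n : 0 <= V n by exact: sumr_ge0.
have VE n : V n = \sum_(0 <= k < n) `|renewal k - renewal k.+1| - `|renewal 0 - renewal 1|
     + `|renewal n - renewal n.+1|.
  by rewrite /V addrAC -big_nat_recr//= [in RHS]big_nat_recl// [in RHS]addrC addKr big_add1.
have dM k : `|renewal k - renewal k.+1| <= (pi s)^-1.
  have := vM k; have := vM k.+1; have := v0 k; have := v0 k.+1.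
  by rewrite ler_norml => *; lra.
split=> [[_ /cvg_within0 H] e e0|H].
  have e20 : 0 < e / 2 by lra.
  have [N HN] := H _ e20.
  have [N' HN'] := eventually_green (4 * (pi s)^-1 / e + 4 * (pi s)^-1 + 1).
  exists (maxn N N') => n; rewrite geq_max => /andP[Nn Nn'] Kn.
  have := HN n Nn Kn; have := HN' n Nn'; move=> g0.
  have w0 : 0 < weight_sum renewal n.
    have : 0 < (pi s)^-1 / e by exact: divr_gt0.
    by have := vM 0%N; have := v0 n; rewrite wE; lra.
  rewrite -/(V n) ger0_norm ?mulr_ge0 ?invr_ge0 ?(ltW w0)// ler_pdivrMl// wE => hV.
  have := VE n; have := dM 0%N; have := normr_ge0 (renewal n - renewal n.+1).
  set s1 := \sum_(0 <= k < n) _ => h1 h2 h3.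
  have h4 : s1 <= (pi s)^-1 + e / 2 * (green n + (pi s)^-1).
    apply: (@le_trans _ _ ((pi s)^-1 + V n)); first by lra.
    rewrite lerD2l; apply: le_trans hV _; rewrite mulrC ler_pM2l//.
    by have := vM n; have := v0 0%N; lra.
  apply: le_trans h4 _.
  have : 4 * (pi s)^-1 <= e * (green n - 4 * (pi s)^-1 - 1).
    rewrite -ler_pdivrMl// mulrC; lra.
  have ep0 : 0 < e * (pi s)^-1 by exact: mulr_gt0.
  by move=> h5; lra.
split; first exact: weight_renewal.
apply/cvg_within0 => e e0; have e40 : 0 < e / 4 by lra.
have [N HN] := H _ e40.
have [N' HN'] := eventually_green (4 * (pi s)^-1 / e + 4 * (pi s)^-1 + 1).
exists (maxn N N') => n; rewrite geq_max => /andP[Nn Nn'] Kn.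
have := HN n Nn Kn; have := HN' n Nn'; move=> g0.
have w0 : 0 < weight_sum renewal n.
  have : 0 < (pi s)^-1 / e by exact: divr_gt0.
  by have := vM 0%N; have := v0 n; rewrite wE; lra.
rewrite -/(V n) => hs.
rewrite ger0_norm ?mulr_ge0 ?invr_ge0 ?(ltW w0)// ler_pdivrMl// wE.
have := VE n; have := dM n; have := normr_ge0 (renewal 0 - renewal 1).
move: hs; set s1 := \sum_(0 <= k < n) _ => hs h1 h2 h3.
have h4 : V n <= (pi s)^-1 + e / 4 * green n by lra.
apply: le_trans h4 _.
have h5 : 4 * (pi s)^-1 <= e * (green n - 4 * (pi s)^-1 - 1).
  rewrite -ler_pdivrMl// mulrC; lra.
apply: (@le_trans _ _ ((green n - (pi s)^-1) * e)); last first.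
  by rewrite ler_pM2r//; have := vM 0%N; have := v0 n; lra.
have ep0 : 0 < e * (pi s)^-1 by exact: mulr_gt0.
by lra.
Qed.

End SmallAlong.

(** * Smoothness of v implies mixing on [s]_0 *)

Section SmoothMixing.
Implicit Types (x y : int -> S) (E G : set X).

(** Eventually m(C) a_n exceeds the window term, so the bracket in [sum_hits] is at most 2 m(C) a_n
    and the constant 3/2 becomes 3. *)
Lemma small_hits a b C D (eta : R) : block a b C -> measurable D -> D `<=` C ->
  0 < eta -> 0 < mf C -> mf D <= eta ^+ 2 * mf C ->
  small_along (3 * eta * mf C ^+ 2) (fun k => mf (D `&` C @- k)) /\
  small_along (3 * eta * mf C ^+ 2) (fun k => mf (C `&` D @- k)).
Proof.
move=> bC mD DC eta0 C0 De.
have B : exists N, forall n, (N <= n)%N ->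
    3 / 2 * eta * mf C * ((a + b).+1%:R + mf C * green n) <= 3 * eta * mf C ^+ 2 * green n.
  have [N HN] := eventually_green ((a + b).+1%:R / mf C); exists N => n Nn.
  have : (a + b).+1%:R <= mf C * green n by rewrite -ler_pdivrMl// mulrC HN.
  move=> h; rewrite (_ : 3 * eta * _ ^+ 2 * _ =
    3 / 2 * eta * mf C * (mf C * green n + mf C * green n)); last by field.
  by rewrite ler_wpM2l ?lerD2r// !mulr_ge0// ltW.
split; apply: small_bound B => n.
  under eq_bigr do rewrite ger0_norm ?fine_measure_ge0//.
  exact: sum_hits.
under eq_bigr do rewrite ger0_norm ?fine_measure_ge0//.
exact: sum_hits_back.
Qed.

Lemma corr_close (A B U V D1 D2 G : set X) k :
  measurable A -> measurable B -> measurable U -> measurable V ->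
  measurable D1 -> measurable D2 -> measurable G -> m G \is a fin_num ->
  A `<=` G -> B `<=` G -> U `<=` G -> V `<=` G ->
  symdiff A U `<=` D1 -> symdiff B V `<=` D2 ->
  `|mf (A `&` B @- k) - mf (U `&` V @- k)| <= mf (D1 `&` G @- k) + mf (G `&` D2 @- k).
Proof.
move=> mA mB mU mV mD1 mD2 mG fG AG BG UG VG AUD BVD.
have mS E : measurable E -> measurable (E @- k) by exact: shiftz_measurable.
have fI E F : measurable E -> measurable F -> E `<=` G -> m (E `&` F) \is a fin_num.
  by move=> mE mF EG; apply: fin_measure_sub fG => //; [exact: measurableI|move=> x [/EG]].
have fGk : m (G @- k) \is a fin_num by rewrite m_shift.
have fD1 : m (D1 `&` G @- k) \is a fin_num.
  by apply: fin_measure_sub fGk => //; [apply: measurableI => //; exact: mS|exact: mS].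
have fD2 : m (G `&` D2 @- k) \is a fin_num by apply: fI => //; exact: mS.
apply: le_trans (fine_measure_distance _ _ _ _) _;
  try by [apply: measurableI => //; exact: mS|apply: fI => //; exact: mS].
have m1 : measurable (D1 `&` G @- k) by apply: measurableI => //; exact: mS.
have m2 : measurable (G `&` D2 @- k) by apply: measurableI => //; exact: mS.
apply: le_trans (fine_measureU m1 m2 fD1 fD2); apply: fine_measure_le.
- by apply: symdiff_measurable; apply: measurableI => //; exact: mS.
- exact: measurableU.
- move=> x [[[Ax Bx] nUV]|[[Ux Vx] nAB]].
    have [Ux|nU] := pselect (U x); last first.
      by left; split; [apply: AUD; left|exact: BG].
    by right; split; [exact: AG|apply: BVD; left; split => // Vx; apply: nUV].
  have [Ax|nA] := pselect (A x); last first.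
    by left; split; [apply: AUD; right|exact: VG].
  by right; split; [exact: AG|apply: BVD; right; split => // Bx; apply: nAB].
- rewrite ge0_fin_numE ?measure_ge0//; apply: le_lt_trans (measureU2 _ m1 m2) _.
  by rewrite ltey_eq fin_numD fD1 fD2.
Qed.

(** Beyond the first h terms, the delay replaces v_k by v_(k-h), and the sum of these differences is
    at most h times the variation of v. *)
Lemma block_mixing a b a' b' C C' e : smooth_renewal -> 0 < e ->
  block a b C -> block a' b' C' ->
  small_along e (fun k => mf (C `&` C' @- k) - mf C * mf C' * renewal k).
Proof.
move=> sm e0 bC bC'; set h := (b + a')%N; set c := mf C * mf C'.
have c0 : 0 <= c by rewrite mulr_ge0// fine_measure_ge0.
have e20 : 0 < e / 2 by lra.
pose f k := if (k < h)%N then mf (C `&` C' @- k) - c * renewal k else 0.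
pose g k := if (k < h)%N then 0 else renewal (k - h) - renewal k.
have sf : small_along (e / 2) f.
  by apply: (small_finite (h := h)) => // k hk; rewrite /f ltnNge hk.
(* The added 1 guards against [c * h%:R] being 0. *)
pose e1 := e / 2 / (c * h%:R + 1).
have ch0 : 0 <= c * h%:R by rewrite mulr_ge0.
have e10 : 0 < e1 by apply: divr_gt0 => //; lra.
have sg : small_along (h%:R * e1) g.
  have [N HN] := sm _ e10; exists N => n Nn Kn.
  apply: (@le_trans _ _ (h%:R * \sum_(0 <= k < n) `|renewal k - renewal k.+1|)); last first.
    by rewrite -mulrA ler_wpM2l// HN.
  have [nh|hn] := leqP n h.
    rewrite big_nat_cond big1 ?mulr_ge0 ?sumr_ge0// => k; rewrite andbT => /andP[_ kn].
    by rewrite /g ifT ?normr0//; lia.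
  rewrite (@big_cat_nat _ _ _ h)//=; last exact: ltnW.
  rewrite big_nat_cond big1 ?add0r; last first.
    by move=> k; rewrite andbT => /andP[_ kn]; rewrite /g kn normr0.
  rewrite -{1}[h]add0n big_addn.
  rewrite (@eq_big_nat _ _ _ _ _ _ (fun k => `|renewal k - renewal (k + h)%N|)); last first.
    by move=> k _; rewrite /g ifF ?addnK//; lia.
  by apply: le_trans (shift_diff_sum _ _ _) _; rewrite subnK// ltnW.
have scg : small_along (c * (h%:R * e1)) (fun k => c * g k).
  by apply: (small_scale c0 sg) => k; rewrite normrM ger0_norm.
apply: small_le (small_add sf scg _) _ => [k|].
  rewrite /f /g; case: ltnP => hk; first by rewrite mulr0 normr0 addr0.
  rewrite normr0 add0r (block_mix bC bC')//.
  by rewrite -/c -mulrBr.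
have -> : e / 2 + c * (h%:R * e1) = e / 2 + e / 2 * (c * h%:R / (c * h%:R + 1)).
  by rewrite /e1; field; rewrite gt_eqF//; lra.
have : c * h%:R / (c * h%:R + 1) <= 1 by rewrite ler_pdivrMr; lra.
by move=> hh; have := ler_wpM2l (ltW e20) hh; lra.
Qed.

Lemma corr_bigcup n n' (C C' : nat -> set X) k :
  (forall i, measurable (C i)) -> (forall i, measurable (C' i)) ->
  (forall i, m (C i) \is a fin_num) -> (forall i, m (C' i) \is a fin_num) ->
  trivIset setT C -> trivIset setT C' ->
  mf (\bigcup_(i < n) C i `&` (\bigcup_(j < n') C' j) @- k) =
  \sum_(0 <= i < n) \sum_(0 <= j < n') mf (C i `&` C' j @- k).
Proof.
move=> mC mC' fC fC' tC tC'.
have mS E : measurable E -> measurable (E @- k) by exact: shiftz_measurable.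
rewrite fine_measure_bigcup//; last by apply: mS; exact: bigcup_measurable.
apply: eq_bigr => i _; rewrite setIC preimage_bigcup fine_measure_bigcup//.
- by apply: eq_bigr => j _; rewrite setIC.
- by move=> j; exact: mS.
- apply/trivIsetP => j l _ _ jl; rewrite -preimage_setI.
  by move/trivIsetP : tC' => ->//; rewrite preimage_set0.
- by move=> j; rewrite m_shift.
Qed.

Definition mixing_on_state := forall (A B : set X) e, measurable A -> measurable B ->
  A `<=` coord_set 0 s -> B `<=` coord_set 0 s -> 0 < e ->
  small_along e (fun k => mf (A `&` B @- k) - mf A * mf B * renewal k).

Lemma smooth_mixing : smooth_renewal -> mixing_on_state.
Proof.
move=> sm A B e mA mB As Bs e0.
have ms : measurable (coord_set 0 s : set X) by exact: coord_measurable.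
have fs : m (coord_set 0 s) \is a fin_num by apply: (m_sub_coord ms (@subset_refl _ _)).
have ps : mf (coord_set 0 s) = pi s by rewrite m_coord.
(* Replacing the sets costs 6 eta pi_s^2 and replacing their masses 2 eta pi_s^2; the factor 16
   makes this at most e / 2, and the blocks take the other half. *)
pose eta := Num.min 1 (e / (16 * pi s ^+ 2)).
have p2 : 0 < pi s ^+ 2 by rewrite exprn_gt0.
have eta0 : 0 < eta by rewrite lt_min ltr01 divr_gt0//; lra.
have eta1 : eta <= 1 by rewrite ge_min lexx.
have etae : eta * (16 * pi s ^+ 2) <= e.
  by rewrite -ler_pdivlMr; [rewrite ge_min lexx orbT|lra].
have eta2 : 0 < eta ^+ 2 * pi s by rewrite mulr_gt0 ?exprn_gt0.
have [n [C [bC tC AC]]] := block_approx mA As eta2.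
have [n' [C' [bC' tC' BC]]] := block_approx mB Bs eta2.
set U := \bigcup_(i < n) C i in AC; set V := \bigcup_(i < n') C' i in BC.
have mC i : measurable (C i) by have [a [b []]] := bC i.
have mC' i : measurable (C' i) by have [a [b []]] := bC' i.
have fC i : m (C i) \is a fin_num by have [a [b /block_fin]] := bC i.
have fC' i : m (C' i) \is a fin_num by have [a [b /block_fin]] := bC' i.
have mU : measurable U by exact: bigcup_measurable.
have mV : measurable V by exact: bigcup_measurable.
have Us : U `<=` coord_set 0 s.
  by move=> x [i _]; have [a [b [_ _ Cs _ _]]] := bC i; exact: Cs.
have Vs : V `<=` coord_set 0 s.
  by move=> x [i _]; have [a [b [_ _ Cs _ _]]] := bC' i; exact: Cs.
have mAU := symdiff_measurable mA mU; have mBV := symdiff_measurable mB mV.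
have AUs : symdiff A U `<=` coord_set 0 s by move=> x [[/As]|[/Us]].
have BVs : symdiff B V `<=` coord_set 0 s by move=> x [[/Bs]|[/Vs]].
have s0 : 0 < mf (coord_set 0 s) by rewrite ps.
rewrite -ps in AC BC.
(* [s]_0 is itself a block and contains both symmetric differences. *)
have [h1 _] := small_hits coord_block mAU AUs eta0 s0 AC.
have [_ h2] := small_hits coord_block mBV BVs eta0 s0 BC.
have h12 : small_along (6 * eta * pi s ^+ 2) (fun k => mf (A `&` B @- k) - mf (U `&` V @- k)).
  apply: small_le (small_add h1 h2 _) _ => [k|]; last by rewrite ps; lra.
  rewrite [X in _ <= X + _]ger0_norm ?fine_measure_ge0// [X in _ <= _ + X]ger0_norm ?fine_measure_ge0//.
  exact: corr_close.
have e20 : 0 < e / 2 by lra.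
have h3 : small_along (e / 2) (fun k => mf (U `&` V @- k) - mf U * mf V * renewal k).
  have -> : (fun k => mf (U `&` V @- k) - mf U * mf V * renewal k) =
    (fun k => \sum_(i <- index_iota 0 n) \sum_(j <- index_iota 0 n')
      (mf (C i `&` C' j @- k) - mf (C i) * mf (C' j) * renewal k)).
    apply/funext => k; rewrite corr_bigcup//.
    have -> : mf U = \sum_(0 <= i < n) mf (C i).
      rewrite -[U]setIT fine_measure_bigcup//; apply: eq_bigr => i _; by rewrite setIT.
    have -> : mf V = \sum_(0 <= i < n') mf (C' i).
      rewrite -[V]setIT fine_measure_bigcup//; apply: eq_bigr => i _; by rewrite setIT.
    rewrite mulr_suml mulr_suml -sumrB; apply: eq_bigr => i _.
    by rewrite mulr_sumr mulr_suml -sumrB.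
  apply: small_sum => // i e1 e10; apply: small_sum => // j e2 e20'.
  have [a [b bCi]] := bC i; have [a' [b' bCj]] := bC' j.
  exact: block_mixing bCi bCj.
have fA : m A \is a fin_num by exact: m_sub_coord As.
have fB : m B \is a fin_num by exact: m_sub_coord Bs.
have fU : m U \is a fin_num by exact: m_sub_coord Us.
have fV : m V \is a fin_num by exact: m_sub_coord Vs.
have dA := le_trans (fine_measure_distance mA mU fA fU) AC.
have dB := le_trans (fine_measure_distance mB mV fB fV) BC.
have Ble : mf B <= pi s by rewrite -ps; exact: fine_measure_le.
have Ule : mf U <= pi s by rewrite -ps; exact: fine_measure_le.
have B0 := fine_measure_ge0 m B; have U0 := fine_measure_ge0 m U.
have h4 : small_along (2 * eta * pi s ^+ 2) (fun k => (mf U * mf V - mf A * mf B) * renewal k).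
  exists 0%N => l _ _; under eq_bigr do rewrite normrM [X in _ * X]ger0_norm ?renewal_ge0//.
  rewrite -mulr_sumr ler_wpM2r ?green_ge0//.
  rewrite ps in dA dB.
  have -> : mf U * mf V - mf A * mf B = - (mf A - mf U) * mf B - mf U * (mf B - mf V) by ring.
  apply: le_trans (ler_normB _ _) _; rewrite !normrM normrN (ger0_norm B0) (ger0_norm U0).
  have q1 : `|mf A - mf U| * mf B <= eta ^+ 2 * pi s * pi s by apply: ler_pM.
  have q2 : mf U * `|mf B - mf V| <= pi s * (eta ^+ 2 * pi s) by apply: ler_pM.
  have q3 : eta ^+ 2 * pi s ^+ 2 <= eta * pi s ^+ 2.
    by rewrite ler_pM2r// expr2 -[leRHS]mulr1 ler_pM2l.
  by lra.
apply: small_le (small_add h12 (small_add h3 h4 (fun k => ler_normD _ _)) _) _ => [k|].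
  by apply: le_trans (ler_normD _ _); rewrite le_eqVlt; apply/orP; left; apply/eqP; congr (`|_|); ring.
by lra.
Qed.

End SmoothMixing.

Hypothesis P_irr : irreducible_mx P.

(** * From mixing on [s]_0 to rational weak mixing *)

Section Equivalence.
Implicit Types (x y : int -> S) (E G : set X).

(** If A never meets the later preimages of B, the correlation sum is m(A) m(B) a_n up to a bounded
    term, too large for mixing unless the product vanishes. Time 0 is excluded so that A = B may be
    a wandering set. *)
Lemma mixing_null A B : infinite_set K -> mixing_on_state ->
  measurable A -> measurable B -> A `<=` coord_set 0 s -> B `<=` coord_set 0 s ->
  (forall k, A `&` B @- k.+1 = set0) -> m A = 0%E \/ m B = 0%E.
Proof.
move=> Kinf mix mA mB As Bs AB0.
have fA : m A \is a fin_num by exact: m_sub_coord As.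
have fB : m B \is a fin_num by exact: m_sub_coord Bs.
have [c0|c0] := eqVneq (mf A * mf B) 0.
  move/eqP: c0; rewrite mulf_eq0 => /orP[/eqP h|/eqP h]; [left|right].
    by rewrite -(fineK fA) h.
  by rewrite -(fineK fB) h.
set c := mf A * mf B in c0.
have {}c0 : 0 < c by rewrite lt_def c0 mulr_ge0// fine_measure_ge0.
have c20 : 0 < c / 2 by lra.
have [N HN] := mix A B _ mA mB As Bs c20.
have [N' HN'] := eventually_green (2 * renewal 0 + 1).
have [n [Nn Kn]] : exists n, (maxn N N' <= n)%N /\ K n.
  apply: contrapT => H; apply: Kinf.
  apply: (sub_finite_set _ (finite_II (maxn N N'))) => n Kn /=.
  by rewrite ltnNge; apply/negP => h; apply: H; exists n.
rewrite geq_max in Nn; case/andP: Nn => Nn Nn'.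
have := HN n Nn Kn; have := HN' n Nn'; have := renewal_ge0 0.
case: n {Nn Nn' Kn} => [|n].
  by rewrite /green big_geq// => ? ?; exfalso; lra.
move=> r0 g0; rewrite big_nat_recl//= => H; exfalso.
have : \sum_(0 <= k < n) `|mf (A `&` B @- k.+1) - c * renewal k.+1| = c * (green n.+1 - renewal 0).
  rewrite /green big_nat_recl//= [renewal 0 + _]addrC addrK mulr_sumr.
  apply: eq_bigr => k _; rewrite AB0 measure0 /= sub0r normrN ger0_norm//.
  by rewrite mulr_ge0 ?renewal_ge0 ?ltW.
move=> E; rewrite E in H.
have h0 := normr_ge0 (mf (A `&` B @- 0) - c * renewal 0).
have : c / 2 * (2 * renewal 0 + 1) <= c / 2 * green n.+1 by rewrite ler_pM2l.
rewrite -/c in H; lra.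
Qed.


(** Almost every path is at s at some time -k <= 0, and E & {x_-k = s} has the mass of its translate
    T^-k E & [s]_0; null statements on [s]_0 thus spread to the whole space. *)
Lemma sweep_null (E : set X) : measurable E ->
  (forall k, m (E @- k `&` coord_set 0 s) = 0%E) -> m E = 0%E.
Proof.
move=> mE E0.
have mc k : measurable (E `&` coord_set (- k%:Z) s).
  by apply: measurableI => //; exact: coord_measurable.
have m1 : measurable (never_before 1) by exact: never_before_measurable.
have mU : measurable (\bigcup_(k : nat) (E `&` coord_set (- k%:Z) s)) by exact: bigcupT_measurable.
have U0 : m (\bigcup_(k : nat) (E `&` coord_set (- k%:Z) s)) = 0%E.
  apply: null_bigcup => // k; rewrite -(m_shift k%:Z)// preimage_setI shiftz_coord.
  by rewrite addNr.
have mV := measurableU _ _ mU m1.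
apply: (null_sub mE mV); last first.
  by rewrite (measureU0 mU m1 (past_visit P_irr)).
move=> x Ex; have [nb|/existsNP[j /not_implyP[j1 /contrapT xj]]] := pselect (never_before 1 x).
  by right.
left; exists (absz j) => //; split => //; rewrite /coord_set /= -xj; congr x; lia.
Qed.

Lemma mixing_conservative : infinite_set K -> mixing_on_state ->
  conservative m shift_map.
Proof.
move=> Kinf mix W [mW tW]; apply: sweep_null => // k.
have ms : measurable (coord_set 0 s : set X) by exact: coord_measurable.
have mWk : measurable (W @- k `&` coord_set 0 s).
  by apply: measurableI => //; exact: shiftz_measurable.
have sub : W @- k `&` coord_set 0 s `<=` coord_set 0 s by move=> x [].
have [] // := mixing_null Kinf mix mWk mWk sub sub.
move=> j; apply/seteqP; split => // x [[Wk _] [Wkj _]].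
have : k = (k + j.+1)%N; last by lia.
apply: tW => //; exists x; split; rewrite iter_shift//.
by move: Wkj; rewrite /shiftz /= /preimage /=; congr W; apply/funext => i; congr x; lia.
Qed.

Lemma mixing_ergodic : infinite_set K -> mixing_on_state -> ergodic m shift_map.
Proof.
move=> Kinf mix A mA TA.
have TkA k : A @- k = A.
  elim: k => [|k IH]; first exact: shiftz0.
  rewrite (_ : k.+1%:Z = k%:Z + 1%:Z); last lia.
  by rewrite -shiftz_comp (_ : A @- 1 = A) // -[RHS]TA -[shift_map]/(iter 1 shift_map) iter_shift.
have ms : measurable (coord_set 0 s : set X) by exact: coord_measurable.
have mA1 : measurable (A `&` coord_set 0 s) by exact: measurableI.
have mA2 : measurable (~` A `&` coord_set 0 s).
  by apply: measurableI => //; exact: measurableC.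
have sub (B : set X) : B `&` coord_set 0 s `<=` coord_set 0 s by move=> x [].
have disj k : (A `&` coord_set 0 s) `&` (~` A `&` coord_set 0 s) @- k.+1 = set0.
  apply/seteqP; split => // x [[Ax _] [nA _]]; apply: nA.
  by rewrite -(TkA k.+1) in Ax.
have [h|h] := mixing_null Kinf mix mA1 mA2 (sub _) (sub _) disj; [left|right].
  by apply: sweep_null => // k; rewrite TkA.
apply: sweep_null => [|k]; first exact: measurableC.
by rewrite -preimage_setC TkA.
Qed.

Lemma shift_mapE : shift_map = shiftz 1%:Z :> (X -> X).
Proof. by rewrite -iter_shift. Qed.

Lemma return_weight_state : return_weight m shift_map (coord_set 0 s) = renewal.
Proof.
apply/funext => k; rewrite /return_weight iter_shift (block_mix coord_block coord_block)//.
rewrite addn0 subn0 m_coord /= expr2 mulrAC divff ?mul1r//.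
by rewrite mulf_neq0// gt_eqF.
Qed.

(** In the indexing of cylinders [s]_0 constrains x_1, so it is T^-1 of [coord_set 0 s]; invariance
    makes the weights agree. *)
Lemma return_weight_state_cylinder :
  return_weight m shift_map (state_cylinder s) = renewal.
Proof.
rewrite -return_weight_state; apply/funext => k; rewrite /return_weight !iter_shift.
have -> : state_cylinder s = (coord_set 0 s) @- 1.
  apply/seteqP; split => x /=; last by move=> x1 j j1; rewrite (_ : j = 1%N)//; lia.
  by move=> /(_ 1%N isT); rewrite /shiftz.
have ms : measurable (coord_set 0 s : set X) by exact: coord_measurable.
rewrite m_shift// shiftz_comp addrC -shiftz_comp -preimage_setI m_shift//.
by apply: measurableI => //; exact: shiftz_measurable.
Qed.

Lemma mixing_rwm : infinite_set K -> mixing_on_state ->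
  rationally_weakly_mixing_along K m shift_map.
Proof.
move=> Kinf mix; have ms : measurable (coord_set 0 s : set X) by exact: coord_measurable.
split; [|exact: mixing_conservative|exact: mixing_ergodic|].
  rewrite shift_mapE; split; first exact: shiftz_measurable_fun.
  by move=> A mA; exact: m_shift.
exists (coord_set 0 s); split => //; first by rewrite m_coord lte_fin pi_s ltry.
move=> A B mA mB As Bs; apply/cvg_within0 => e e0.
have [N HN] := mix A B e mA mB As Bs e0; exists N => n Nn Kn.
rewrite /return_sum return_weight_state -/(green n).
have := HN n Nn Kn; set x := \sum_(0 <= k < n) _ => Hx.
rewrite (_ : \sum_(0 <= k < n) _ = x); last by apply: eq_bigr => k _; rewrite iter_shift.
have g0 := green_ge0 n; have x0 : 0 <= x by exact: sumr_ge0.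
rewrite ger0_norm ?mulr_ge0 ?invr_ge0//.
have [->|gn] := eqVneq (green n) 0; first by rewrite invr0 mul0r ltW.
by rewrite ler_pdivrMl ?lt_def ?gn// mulrC.
Qed.

(** * From rational weak mixing to smoothness *)

Lemma sum_shifted h n :
  \sum_(0 <= k < n) (if (k < h)%N then 0 else renewal (k - h)) <= green n.
Proof.
have [nh|hn] := leqP n h.
  rewrite big_nat_cond big1 ?green_ge0// => k; rewrite andbT => /andP[_ kn].
  by rewrite ifT//; lia.
rewrite (@big_cat_nat _ _ _ h)//=; last exact: ltnW.
rewrite big_nat_cond big1 ?add0r; last first.
  by move=> k; rewrite andbT => /andP[_ ->].
rewrite -{1}[h]add0n big_addn.
rewrite (@eq_big_nat _ _ _ _ _ _ renewal); last first.
  by move=> k _; rewrite ifF ?addnK//; lia.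
by apply: le_green; lia.
Qed.

(** Rational weak mixing inside A with a foreign reference sequence u, but normalised by
    a_n([s]_0). *)
Definition comparable_to (A : set X) (u : nat -> R) := forall (A1 B1 : set X) e,
  measurable A1 -> measurable B1 -> A1 `<=` A -> B1 `<=` A -> 0 < e ->
  small_along e (fun k => mf (A1 `&` B1 @- k) - mf A1 * mf B1 * u k).

(* C is a block almost filled by A; prolonging C to the right by q steps back to s
   delays the correlation sequence of C by q, whereas the one of A stays close to u. *)
Lemma delayed_compare A u a b C q h (c eta : R) :
  h = (b + q + a)%N -> measurable A -> comparable_to A u ->
  block a b C -> 0 < mf C -> 0 < c -> c <= 1 -> 0 < eta -> eta <= 1 / 2 ->
  mf (C `\` A) <= (eta * c) ^+ 2 * mf C -> c <= fine (mpow P q s s) ->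
  small_along (36 * eta) (fun k => if (k < h)%N then 0 else renewal (k - h) - u k).
Proof.
move=> hE mA cmp bC x0 c0 c1 eta0 eta1 D0x cq.
have mC : measurable C by case: bC.
have fC := block_fin bC.
pose Cq := C `&` (coord_set 0 s) @- (b + q).
have bq : block a (b + q) Cq.
  by rewrite -[(b + q)%N]addn0; apply: (block_inter bC coord_block); rewrite ?addn0 ?leq_addr.
have {hE} mix k : (h <= k)%N -> mf (Cq `&` C @- k) = mf Cq * mf C * renewal (k - h).
  by rewrite hE => hk; exact: (block_mix bq bC hk).
have mCq : measurable Cq by case: bq.
have fCq := block_fin bq.
have CqC : Cq `<=` C by move=> y [].
have Cqx : mf Cq = mf C * fine (mpow P q s s).
  rewrite /Cq (block_mix bC coord_block) ?addn0 ?leq_addr//.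
  rewrite addKn m_coord /= /renewal; field; by rewrite gt_eqF.
pose D := C `\` A; have mD : measurable D by exact: measurableD.
pose Aq := A `&` Cq; pose B := A `&` C.
have mAq : measurable Aq by exact: measurableI.
have mB : measurable B by exact: measurableI.
(* The factor c compensates the final division by M, whose lower bound is only c m(C)^2 / 4. *)
set t := eta * c in D0x; have t0 : 0 < t by exact: mulr_gt0.
have DC : D `<=` C by move=> y [].
have fD : m D \is a fin_num by exact: fin_measure_sub fC.
have [h1 h2] := small_hits bC mD DC t0 x0 D0x.
set x := mf C in x0 D0x Cqx h1 h2.
have xq : mf Cq <= x by exact: fine_measure_le.
have Bx : x = mf D + mf B by rewrite /x (fine_measureDI mC mA)// setIC.
have Aqx : mf Cq <= mf D + mf Aq.
  rewrite (fine_measureDI mCq mA)// setIC lerD2r; apply: fine_measure_le => //.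
    exact: measurableD.
  by move=> y [/CqC].
have Aqq : mf Aq <= mf Cq by apply: fine_measure_le => // y [].
have d0 := fine_measure_ge0 m D.
(* Since m([Cq]) >= c m(C), this leaves at least half of [Cq], and of C, inside A. *)
have tc : t ^+ 2 <= c / 4.
  have e2 : eta ^+ 2 <= 1 / 4.
    by rewrite expr2 (_ : 1 / 4 = 1 / 2 * (1 / 2)); [apply: ler_pM => //; exact: ltW|field].
  have cc : c ^+ 2 <= c by rewrite expr2 -[leRHS]mulr1 ler_pM2l.
  have := ler_pM (sqr_ge0 eta) (sqr_ge0 c) e2 cc; rewrite -exprMn -/t; lra.
have t1 : t <= 1 by rewrite /t -[1]mulr1; apply: ler_pM => //; [exact: ltW|exact: ltW|lra].
have xc0 : 0 < x * c by exact: mulr_gt0.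
have tx : t ^+ 2 * x <= c / 4 * x by rewrite ler_pM2r.
have cx : c * x <= x by rewrite -[leRHS]mul1r ler_pM2r.
have pq : x * c <= mf Cq by rewrite Cqx ler_pM2l.
have Aq2 : x * c / 2 <= mf Aq by lra.
have B2 : x / 2 <= mf B by lra.
set M := mf Aq * mf B.
have Mge : x * c / 2 * (x / 2) <= M by apply: ler_pM => //; lra.
have M0 : 0 < M.
  by apply: lt_le_trans Mge; rewrite mulr_gt0; lra.
pose w k := if (k < h)%N then 0 else renewal (k - h).
have w0 k : 0 <= w k by rewrite /w; case: ifP => // _; exact: renewal_ge0.
pose f1 k := (mf Cq * x - M) * w k.
have s1 : small_along (2 * t ^+ 2 * x ^+ 2) f1.
  exists 0%N => n _ _; under eq_bigr do rewrite /f1 normrM [X in _ * X]ger0_norm//.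
  rewrite -mulr_sumr; apply: ler_pM => //; [exact: sumr_ge0| |exact: sum_shifted].
  have -> : mf Cq * x - M = (mf Cq - mf Aq) * x + mf Aq * (x - mf B) by rewrite /M; ring.
  have q1 : (mf Cq - mf Aq) * x <= t ^+ 2 * x * x by rewrite ler_pM2r//; lra.
  have q2 : mf Aq * (x - mf B) <= x * (t ^+ 2 * x) by apply: ler_pM => //; lra.
  have q3 : 0 <= (mf Cq - mf Aq) * x by apply: mulr_ge0; lra.
  have q4 : 0 <= mf Aq * (x - mf B) by apply: mulr_ge0; lra.
  by rewrite ger0_norm; lra.
pose f2 k := mf (Cq `&` C @- k) - mf (Aq `&` B @- k).
have s2 : small_along (6 * t * x ^+ 2) f2.
  apply: small_le (small_add h1 h2 _) _ => [k|]; last by lra.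
  rewrite [X in _ <= X + _]ger0_norm ?fine_measure_ge0// [X in _ <= _ + X]ger0_norm ?fine_measure_ge0//.
  apply: corr_close => //.
  - by move=> y [_ /CqC].
  - by move=> y [].
  - move=> y [[Cy nA]|[[Ay Cy] nC]] //.
    by split; [exact: CqC|move=> Ay; apply: nA].
  - move=> y [[Cy nA]|[[Ay Cy] nC]] //.
    by split => // Ay; apply: nA.
have tx0 : 0 < t * x ^+ 2 by rewrite mulr_gt0// exprn_gt0.
have s3 : small_along (t * x ^+ 2) (fun k => mf (Aq `&` B @- k) - M * u k).
  by apply: cmp => // y [].
have s23 := small_add s2 s3 (fun k => ler_normD _ _).
have M1 : 0 <= M^-1 by rewrite invr_ge0 ltW.
(* From h on, M (w - u) is -f1 + f2 plus the comparability defect of [Aq] and [B]. *)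
have := small_add s1 s23 (z := fun k => M * (if (k < h)%N then 0 else renewal (k - h) - u k)).
move=> /(_ _)/(small_scale M1) sM.
apply: small_le (sM _ _ _) _ => [k|k|].
- case: ltnP => hk; first by rewrite mulr0 normr0 addr_ge0.
  rewrite -[X in _ <= X + _]normrN; apply: le_trans (ler_normD _ _).
  rewrite /f1 /f2 mix// /w ltnNge hk /= -/x.
  by rewrite le_eqVlt; apply/orP; left; apply/eqP; congr (`|_|); ring.
- by rewrite normrM [`|M|]gtr0_norm// mulKf ?gt_eqF.
(* The levels add up to at most 9 t x^2, and M >= c x^2 / 4 with t = eta c gives the factor 36. *)
- rewrite ler_pdivrMl//.
  have q1 : t ^+ 2 * x ^+ 2 <= t * x ^+ 2 by rewrite ler_pM2r ?exprn_gt0// expr2 -[leRHS]mulr1 ler_pM2l.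
    have q2 : 36 * eta * (x * c / 2 * (x / 2)) <= 36 * eta * M by rewrite ler_pM2l//; lra.
    have q3 : 36 * eta * (x * c / 2 * (x / 2)) = 9 * (t * x ^+ 2) by rewrite /t; field.
    rewrite [M * _]mulrC. by lra.
Qed.

Lemma comparable_smooth A u : measurable A -> A `<=` coord_set 0 s -> 0 < mf A ->
  comparable_to A u -> aperiodic P -> smooth_renewal.
Proof.
move=> mA As A0 cmp aper e e0.
have [r [r0 r1]] := aperiodic_consecutive s P_irr aper.
have fgt k : (0 < mpow P k s s)%E -> 0 < fine (mpow P k s s).
  by move=> h; rewrite fine_gt0// h ltey_eq mpow_fin.
(* A common lower bound for both return probabilities lets a single block serve both
   prolongations. *)
pose c := Num.min 1 (Num.min (fine (mpow P r s s)) (fine (mpow P r.+1 s s))).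
have c0 : 0 < c by rewrite !lt_min ltr01 !fgt.
have c1 : c <= 1 by rewrite ge_min lexx.
have cr : c <= fine (mpow P r s s) by rewrite !ge_min lexx !orbT.
have cr1 : c <= fine (mpow P r.+1 s s) by rewrite !ge_min lexx !orbT.
(* Two comparisons at level 36 eta make at most e / 2; the other half pays for the last h + 1
   differences, lost through the delay. *)
pose eta := Num.min (1 / 2) (e / 144).
have eta0 : 0 < eta by rewrite lt_min; apply/andP; split; lra.
have eta1 : eta <= 1 / 2 by rewrite ge_min lexx.
have etae : eta <= e / 144 by rewrite ge_min lexx orbT.
have d0 : 0 < (eta * c) ^+ 2 by rewrite exprn_gt0// mulr_gt0.
have [a [b [C [bC C0 CA]]]] := block_density mA As A0 d0.
have [h [hE hE1]] : exists h, h = (b + r + a)%N /\ h.+1 = (b + r.+1 + a)%N.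
  by exists (b + r + a)%N; rewrite addnS addSn.
have {hE} s1 := delayed_compare hE mA cmp bC C0 c0 c1 eta0 eta1 CA cr.
have {hE1} s2 := delayed_compare hE1 mA cmp bC C0 c0 c1 eta0 eta1 CA cr1.
have s12 := small_add s1 s2 (z := fun k => if (k < h.+1)%N then 0 else renewal (k - h) - renewal (k - h.+1)).
have {s12} [k|N HN] := s12.
  case: ltnP => hk; first by rewrite normr0 addr_ge0.
  rewrite (ltnNge k h) (ltnW hk) /=.
  rewrite -[X in _ <= _ + X]normrN; apply: le_trans (ler_normD _ _).
  by rewrite le_eqVlt; apply/orP; left; apply/eqP; congr (`|_|); ring.
have dM k : `|renewal k - renewal k.+1| <= (pi s)^-1.
  have := renewal_le k; have := renewal_le k.+1; have := renewal_ge0 k; have := renewal_ge0 k.+1.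
  by rewrite ler_norml => *; lra.
have [N' HN'] := eventually_green (2 / e * (h.+1%:R * (pi s)^-1)).
exists (maxn (maxn N N') h.+1) => n; rewrite !geq_max => /andP[/andP[Nn Nn'] hn] Kn.
have := HN n Nn Kn; have := HN' n Nn'.
rewrite (@big_cat_nat _ _ _ h.+1)//= => g1.
rewrite [X in X + _]big_nat_cond [X in X + _]big1 ?add0r; last first.
  by move=> k; rewrite andbT => /andP[_ ->]; rewrite normr0.
rewrite -{1}[h.+1]add0n big_addn.
rewrite (@eq_big_nat _ _ _ _ _ _ (fun k => `|renewal k - renewal k.+1|)); last first.
  by move=> k _; rewrite ltnNge leq_addl /= addnK addnS -addSn addnK distrC.
move=> Hs; rewrite (@big_cat_nat _ _ _ (n - h.+1)) ?leq_subr//=.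
have tail : \sum_(n - h.+1 <= k < n) `|renewal k - renewal k.+1| <= h.+1%:R * (pi s)^-1.
  apply: (@le_trans _ _ (\sum_(n - h.+1 <= k < n) (pi s)^-1)); first exact: ler_sum.
  by rewrite sumr_const_nat subKn// mulr_natl.
have : h.+1%:R * (pi s)^-1 <= e / 2 * green n.
  by rewrite -ler_pdivrMl; [rewrite invf_div|lra].
have q : (36 * eta + 36 * eta) * green n <= e / 2 * green n.
  by rewrite ler_wpM2r ?green_ge0//; lra.
by lra.
Qed.

(** The normalisation has to pass from a_n(F) to a_n([s]_0). For A = F & [s]_0, the hypothesis on
    the pair (A, A) gives, eventually along K, m(A)^2 a_n(F) <= sum_{k<n} m(A & T^-k A) + m(A)^2
    a_n(F) / 2, and the sum is at most pi_s^2 a_n([s]_0). *)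
Lemma rwm_comparable F : measurable F -> m F \is a fin_num ->
  (0 < m (F `&` coord_set 0 s))%E ->
  (forall A B : set X, measurable A -> measurable B -> A `<=` F -> B `<=` F ->
    (return_sum m shift_map F n)^-1 *
      (\sum_(0 <= k < n) `|mf (A `&` iter k shift_map @^-1` B)
         - mf A * mf B * return_weight m shift_map F k|)
      @[n --> within K \oo] --> (0 : R)) ->
  comparable_to (F `&` coord_set 0 s) (return_weight m shift_map F).
Proof.
move=> mF fF A0 rwm.
set u := return_weight m shift_map F; set aF := return_sum m shift_map F.
have ms : measurable (coord_set 0 s : set X) by exact: coord_measurable.
have fs : m (coord_set 0 s) \is a fin_num by rewrite m_coord.
have mA : measurable (F `&` coord_set 0 s) by exact: measurableI.
have AF : F `&` coord_set 0 s `<=` F by move=> x [].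
have As : F `&` coord_set 0 s `<=` coord_set 0 s by move=> x [].
have fA := m_sub_coord mA As.
have u0 k : 0 <= u k by rewrite divr_ge0 ?fine_measure_ge0// sqr_ge0.
have {}A0 : 0 < mf (F `&` coord_set 0 s) by rewrite fine_gt0// A0 ltey_eq fA.
have F0 : 0 < mf F by apply: lt_le_trans A0 _; exact: fine_measure_le.
have aF0 n : 0 < aF n.+1.
  rewrite /aF /return_sum big_nat_recl//=; apply: ltr_wpDr; first exact: sumr_ge0.
  rewrite /return_weight iter_shift shiftz0 setIid.
  by rewrite divr_gt0// exprn_gt0.
have RW (A B : set X) e : measurable A -> measurable B -> A `<=` F -> B `<=` F -> 0 < e ->
    exists N, forall n, (N <= n)%N -> K n ->
    \sum_(0 <= k < n) `|mf (A `&` B @- k) - mf A * mf B * u k| <= e * aF n.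
  move=> mA' mB' AF' BF' e0.
  have /cvg_within0/(_ e e0)[N HN] := rwm A B mA' mB' AF' BF'.
  (* The index 0 is excluded because [aF 0] is 0. *)
  exists N.+1 => -[//|n] Nn Kn.
  have := HN n.+1 (ltnW Nn) Kn; rewrite -/aF -/u.
  rewrite ger0_norm ?mulr_ge0 ?invr_ge0 ?sumr_ge0 ?(ltW (aF0 n))//.
  rewrite ler_pdivrMl// [aF _ * e]mulrC; apply: le_trans.
  by rewrite le_eqVlt; apply/orP; left; apply/eqP; apply: eq_bigr => k _; rewrite iter_shift.
set A := F `&` coord_set 0 s in mA AF As fA A0 *.
pose M := mf A * mf A; have M0 : 0 < M by exact: mulr_gt0.
have M20 : 0 < M / 2 by lra.
have [N1 HN1] := RW A A _ mA mA AF AF M20.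
have ratio n : (N1 <= n)%N -> K n -> M / 2 * aF n <= pi s ^+ 2 * green n.
  move=> Nn Kn; have := HN1 n Nn Kn; set E := \sum_(0 <= k < n) _ => HE.
  suff : M * aF n <= pi s ^+ 2 * green n + E by lra.
  rewrite /aF /return_sum /green !mulr_sumr /E -big_split /=.
  apply: ler_sum => k _.
  have : mf (A `&` A @- k) <= pi s ^+ 2 * renewal k.
    have -> : pi s ^+ 2 * renewal k = mf (coord_set 0 s `&` (coord_set 0 s) @- k).
      by rewrite (block_mix coord_block coord_block)// addn0 subn0 m_coord /= expr2.
    have mS B : measurable B -> measurable (B @- k) by exact: shiftz_measurable.
    have mI : measurable (coord_set 0 s `&` (coord_set 0 s) @- k).
      by apply: measurableI => //; exact: mS.
    apply: fine_measure_le => //.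
    - by apply: measurableI => //; exact: mS.
    - by move=> x [/As ? /As].
    - by apply: fin_measure_sub fs => // x [].
  have := ler_norm (- (mf (A `&` A @- k) - M * u k)); rewrite normrN -/u -/M; lra.
move=> A1 B1 e mA1 mB1 A1A B1A e0.
have p2 : 0 < pi s ^+ 2 by rewrite exprn_gt0.
pose e1 := e * (M / 2) / pi s ^+ 2.
have e10 : 0 < e1 by rewrite divr_gt0// mulr_gt0.
have [N2 HN2] := RW A1 B1 e1 mA1 mB1 (subset_trans A1A AF) (subset_trans B1A AF) e10.
exists (maxn N1 N2) => n; rewrite geq_max => /andP[Nn1 Nn2] Kn.
apply: le_trans (HN2 n Nn2 Kn) _.
have -> : e1 * aF n = e / pi s ^+ 2 * (M / 2 * aF n).
  by rewrite /e1; field; rewrite gt_eqF.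
apply: le_trans (ler_wpM2l _ (ratio n Nn1 Kn)) _.
  by rewrite divr_ge0// ltW.
by rewrite mulrA divfK ?gt_eqF.
Qed.

End Equivalence.

End MarkovShift.

Theorem theorem8p1 (R : realType) (S : pointedType)
  (S_countable : countable [set: S])
  (K : set nat) (K_infinite : infinite_set K)
  (P : S -> S -> R) (pi : S -> R)
  (P_stochastic : stochastic P)
  (P_irreducible : irreducible_mx P)
  (P_recurrent : recurrent P)
  (P_aperiodic : aperiodic P)
  (pi_invariant : invariant_distribution P pi)
  (pi_infinite : \esum_(s in [set: S]) (pi s)%:E = +oo%E)
  (m : {measure set (bilateral S) -> \bar R})
  (m_markov : markov_measure P pi m) :
  rationally_weakly_mixing_along K m shift_map <->
  exists s : S, smooth_along K (return_weight m shift_map (state_cylinder s)).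
Proof.
have [pi_ge0 _] := pi_invariant.
split=> [[_ _ _ [F [mF /andP[F0 Foo] rwm]]]|[s smooth_s]].
  have fF : m F \is a fin_num by rewrite ge0_fin_numE.
  have [s Fs] : exists s, (0 < m (F `&` coord_set 0 s))%E.
    apply: contrapT => nFs; move: F0.
    rewrite (measure_split S_countable m 0 mF) esum1 ?ltxx// => t _.
    apply/eqP; rewrite eq_le measure_ge0 andbT leNgt; apply/negP => ht.
    by apply: nFs; exists t.
  have mA : measurable (F `&` coord_set 0 s).
    by apply: measurableI => //; exact: coord_measurable.
  have pi_s : 0 < pi s.
    rewrite -lte_fin -(m_coord S_countable m_markov 0); apply: lt_le_trans Fs _.
    by apply: le_measure; rewrite ?inE//; exact: coord_measurable.
  exists s; rewrite (return_weight_state_cylinder S_countable P_stochastic pi_ge0 m_markov pi_s).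
  apply/(smooth_alongP P_stochastic pi_ge0 P_recurrent pi_s).
  have As : F `&` coord_set 0 s `<=` coord_set 0 s by exact: subIsetr.
  have fA := m_sub_coord S_countable m_markov mA As.
  apply: (comparable_smooth S_countable P_stochastic pi_ge0 m_markov P_recurrent
    pi_s P_irreducible mA As _ _ P_aperiodic).
    by rewrite fine_gt0// Fs ltey_eq fA.
  exact: (rwm_comparable S_countable P_stochastic pi_ge0 m_markov pi_s mF fF Fs rwm).
(* If pi s were 0, the weight would vanish identically, division by 0 giving 0, and its sums could
   not diverge. *)
have pi_s : 0 < pi s.
  rewrite lt_def pi_ge0 andbT; apply/eqP => pi0.
  have [[_ _ /cvgryPge/(_ 1)[N _ /(_ N (leqnn N)) h]] _] := smooth_s; move: h.
  rewrite /= /weight_sum big1 ?ler10// => k _.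
  rewrite /return_weight (_ : fine (m (state_cylinder s)) = 0).
    by rewrite expr2 mulr0 invr0 mulr0.
  by rewrite /state_cylinder m_markov// pi0 mul0r.
rewrite (return_weight_state_cylinder S_countable P_stochastic pi_ge0 m_markov pi_s) in smooth_s.
apply: (mixing_rwm S_countable P_stochastic pi_ge0 m_markov P_recurrent pi_s) => //.
apply: (smooth_mixing S_countable P_stochastic pi_ge0 m_markov P_recurrent pi_s).
exact/(smooth_alongP P_stochastic pi_ge0 P_recurrent pi_s).
Qed.
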